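(* Suppose that $T\in\mathcal{B}(\mathcal{H})^n$ and $R\in\mathcal{B}(\mathcal{K})^n$ are completely non-coisometric commuting contractive tuples on complex Hilbert spaces $\mathcal{H}$ and $\mathcal{K}$. Then the characteristic functions $\{\mathcal{D}_T,\mathcal{D}_{T^*},\theta_T\}$ and $\{\mathcal{D}_R,\mathcal{D}_{R^*},\theta_R\}$ coincide if and only if $T$ and $R$ are unitarily equivalent.
   Context: $\mathbb{B}_n$ is the open Euclidean unit ball of $\mathbb{C}^n$. A commuting contractive $n$-tuple $T=(T_1,\dots,T_n)$ on $\mathcal{H}$ is a tuple of commuting bounded operators with $\sum_{i=1}^n T_iT_i^*\le 1_{\mathcal{H}}$. The letter $T$ also denotes the row contraction $\mathcal{H}^n\to\mathcal{H}$, $(h_1,\dots,h_n)\mapsto\sum_iT_ih_i$, with adjoint $T^*:h\mapsto(T_1^*h,\dots,T_n^*h)$. Put $D_{T^*}=(1_{\mathcal{H}}-TT^* )^{1/2}$, $\mathcal{D}_{T^*}=\overline{\mathrm{Ran}}\,D_{T^*}$, $D_T=(1_{\mathcal{H}^n}-T^*T)^{1/2}$, $\mathcal{D}_T=\overline{\mathrm{Ran}}\,D_T\subset\mathcal{H}^n$. $T$ is a co-isometry if $T^*:\mathcal{H}\to\mathcal{H}^n$ is an isometry. A commuting contractive tuple $T$ is completely non-coisometric (c.n.c.) if there is no non-trivial (i.e. nonzero) closed joint invariant subspace $\mathcal{M}$ of $T_1^*,\dots,T_n^*$ such that $P_{\mathcal{M}}T|_{\mathcal{M}}=(P_{\mathcal{M}}T_1|_{\mathcal{M}},\dots,P_{\mathcal{M}}T_n|_{\mathcal{M}})$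 is a co-isometry. The characteristic function of $T$ is the operator valued contractive analytic function $\{\mathcal{D}_T,\mathcal{D}_{T^*},\theta_T\}$, $\theta_T(z)=-T+D_{T^*}(1_{\mathcal{H}}-ZT^* )^{-1}ZD_T$ (restricted to $\mathcal{D}_T$, values in $\mathcal{B}(\mathcal{D}_T,\mathcal{D}_{T^*})$), $z\in\mathbb{B}_n$, with row operator $Z=(z_1I_{\mathcal{H}},\dots,z_nI_{\mathcal{H}})$. Operator valued functions $\{\mathcal{E},\mathcal{E}_*,\varphi\}$ and $\{\mathcal{F},\mathcal{F}_*,\psi\}$ (with $\varphi:\mathbb{B}_n\to\mathcal{B}(\mathcal{E},\mathcal{E}_* )$, $\psi:\mathbb{B}_n\to\mathcal{B}(\mathcal{F},\mathcal{F}_* )$ bounded) coincide if there are unitary operators $\tau:\mathcal{E}\to\mathcal{F}$ and $\tau_*:\mathcal{E}_*\to\mathcal{F}_*$ with $\psi(z)\tau=\tau_*\varphi(z)$ for all $z\in\mathbb{B}_n$. $T$ and $R$ are unitarily equivalent if there is a unitary $U:\mathcal{K}\to\mathcal{H}$ with $T_i=UR_iU^*$ for $i=1,\dots,n$. *)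

(* Defs.v *)
From HB Require Import structures.
From mathcomp Require Import all_boot all_order all_algebra.
From mathcomp Require Import complex.
From mathcomp Require Import all_classical all_reals all_analysis.

Set Implicit Arguments.
Unset Strict Implicit.
Unset Printing Implicit Defensive.

Import Order.TTheory GRing.Theory Num.Theory.
Import numFieldNormedType.Exports.

Local Open Scope classical_set_scope.
Local Open Scope ring_scope.

HB.mixin Record CompleteNormedModule_isHilbert (C : numClosedFieldType) H
    & CompleteNormedModule C H := {
  inner : H -> H -> C;
  inner_linearl : forall y, scalar (inner ^~ y);
  innerC : forall x y, inner y x = (inner x y)^*;
  inner_norm : forall x, inner x x = `|x| ^+ 2
}.

#[short(type="hilbertType")]
HB.structure Definition Hilbert (C : numClosedFieldType) :=
  {H of CompleteNormedModule C H & CompleteNormedModule_isHilbert C H}.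

Section BoundedOperators.
Variables (C : numClosedFieldType).

Definition bounded_linear (H K : normedModType C) (f : H -> K) : bool :=
  `[< linear f /\ exists M : C, forall x, `|f x| <= M * `|x| >].

Record bop (H K : normedModType C) :=
  Bop { bop_fun :> H -> K; bop_proof : bounded_linear bop_fun }.

HB.instance Definition _ (H K : normedModType C) :=
  [isSub for @bop_fun H K].
HB.instance Definition _ (H K : normedModType C) :=
  [Choice of bop H K by <:].

Section Closed.
Variables (H K : normedModType C).

Fact bounded_linear_subsemimod_closed :
  GRing.subsemimod_closed (@bounded_linear H K : {pred H -> K}).
Proof.
split; first split.
- apply/asboolP; split; first by move=> a u v; rewrite /= scaler0 addr0.
  by exists 0 => x; rewrite /= normr0 mul0r.
- move=> f g /asboolP[lf [M Mf]] /asboolP[lg [N Ng]]; apply/asboolP; split.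
    by move=> a u v; rewrite !addrfctE lf lg scalerDr addrACA.
  exists (M + N) => x; rewrite !addrfctE mulrDl.
  by apply: le_trans (ler_normD _ _) _; exact: lerD.
- move=> a f /asboolP[lf [M Mf]]; apply/asboolP; split.
    by move=> b u v; rewrite !scalrfctE lf scalerDr !scalerA mulrC.
  exists (`|a| * M) => x; rewrite !scalrfctE normrZ -mulrA.
  exact: ler_wpM2l.
Qed.

HB.instance Definition _ := GRing.isSubmodClosed.Build C (H -> K)
  (@bounded_linear H K) bounded_linear_subsemimod_closed.
HB.instance Definition _ := [SubChoice_isSubLmodule of bop H K by <:].

Fact bop_linear (A : bop H K) : linear A.
Proof. by have /asboolP[] := bop_proof A. Qed.

HB.instance Definition _ (A : bop H K) :=
  GRing.isLinear.Build C H K *:%R A (bop_linear A).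

Fact bop_bounded (A : bop H K) : exists M : C, forall x, `|A x| <= M * `|x|.
Proof. by have /asboolP[] := bop_proof A. Qed.

Fact bop_bounded_ge0 (A : bop H K) :
  exists2 M : C, 0 <= M & forall x, `|A x| <= M * `|x|.
Proof.
have [M Mf] := bop_bounded A; exists `|M| => // x.
have [->|x0] := eqVneq x 0; first by rewrite linear0 !normr0 mulr0.
have M0 : 0 <= M.
  by rewrite -(@pmulr_lge0 _ `|x|) ?normr_gt0//; exact: le_trans (Mf x).
by rewrite ger0_norm.
Qed.
End Closed.

Fact op_id_proof (H : normedModType C) : bounded_linear (@idfun H).
Proof. by apply/asboolP; split => //; exists 1 => x; rewrite mul1r. Qed.

Definition op_id (H : normedModType C) : bop H H := Bop (op_id_proof H).

Fact op_comp_proof (H K L : normedModType C) (A : bop K L) (B : bop H K) :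
  bounded_linear (A \o B).
Proof.
apply/asboolP; split; first by move=> a u v; rewrite /= !linearP.
have [M M0 MA] := bop_bounded_ge0 A; have [N N0 NB] := bop_bounded_ge0 B.
exists (M * N) => x /=; rewrite -mulrA; apply: le_trans (MA _) _.
exact: ler_wpM2l.
Qed.

Definition op_comp (H K L : normedModType C) (A : bop K L) (B : bop H K) :
  bop H L := Bop (op_comp_proof A B).

End BoundedOperators.

Section Power.
Variables (C : numClosedFieldType) (n : nat).

(* Type alias carrying the l2-norm. *)
Definition hpow (H : Type) := {ffun 'I_n -> H}.

HB.instance Definition _ (H : lmodType C) :=
  GRing.Lmodule.copy (hpow H) {ffun 'I_n -> H}.

Definition hpow_norm (H : normedModType C) (h : hpow H) : C :=
  sqrtC (\sum_i `|h i| ^+ 2).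

Section Norm.
Variable H : normedModType C.
Implicit Types h k : hpow H.

Fact sum_sqr_ge0 h : 0 <= \sum_i `|h i| ^+ 2.
Proof. by apply: sumr_ge0 => i _; exact: exprn_ge0. Qed.

Fact hpow_norm_ge0 h : 0 <= hpow_norm h.
Proof. by rewrite sqrtC_ge0 sum_sqr_ge0. Qed.

Fact hpow_norm_sqr h : hpow_norm h ^+ 2 = \sum_i `|h i| ^+ 2.
Proof. by rewrite sqrtCK. Qed.

Fact le_norm_coord h i : `|h i| <= hpow_norm h.
Proof.
rewrite -ler_sqr ?nnegrE ?hpow_norm_ge0 // hpow_norm_sqr (bigD1 i) //=.
by rewrite lerDl; apply: sumr_ge0 => j _; exact: exprn_ge0.
Qed.

Fact sqrtC_row (a : 'I_n -> C) : (forall i, 0 <= a i) ->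
  sqrtC (\sum_i a i ^+ 2) = sqrtC (dotmx (\row_i a i) (\row_i a i)).
Proof.
move=> a0; congr sqrtC; rewrite dotmxE !mxE; apply: eq_bigr => i _.
by rewrite !mxE expr2; congr (_ * _); rewrite (CrealP _) // ger0_real.
Qed.

Fact hpow_normD h k : hpow_norm (h + k) <= hpow_norm h + hpow_norm k.
Proof.
rewrite /hpow_norm (sqrtC_row (a := fun i => `|h i|)) //.
rewrite (sqrtC_row (a := fun i => `|k i|)) //.
set u := \row_i _; set v := \row_i _.
have := (triangle_lerif (@dotmx C n) u v).1; apply: le_trans.
rewrite (_ : u + v = \row_i (`|h i| + `|k i|)); last first.
  by apply/rowP => i; rewrite !mxE.
rewrite -sqrtC_row; last by move=> i; exact: addr_ge0.
rewrite ler_sqrtC ?nnegrE ?sum_sqr_ge0 //; last first.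
  by apply: sumr_ge0 => i _; rewrite exprn_ge0 // addr_ge0.
apply: ler_sum => i _; rewrite ler_sqr ?nnegrE ?addr_ge0 // ffunE.
exact: ler_normD.
Qed.

Fact hpow_normZ a h : hpow_norm (a *: h) = `|a| * hpow_norm h.
Proof.
apply: (@pexpIrn _ 2); rewrite ?nnegrE ?mulr_ge0 ?hpow_norm_ge0 //.
rewrite exprMn !hpow_norm_sqr mulr_sumr; apply: eq_bigr => i _.
by rewrite ffunE normrZ exprMn.
Qed.

Fact hpow_norm0_eq0 h : hpow_norm h = 0 -> h = 0.
Proof.
move=> h0; apply/ffunP => i; rewrite ffunE; apply/eqP; rewrite -normr_le0.
by rewrite -h0 le_norm_coord.
Qed.

HB.instance Definition _ :=
  Lmodule_isNormed.Build C (hpow H) hpow_normD hpow_normZ hpow_norm0_eq0.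

Fact hpow_normE h : `|h| = hpow_norm h. Proof. by []. Qed.

Fact hpow_norm_le_sum h : `|h| <= \sum_i `|h i|.
Proof.
have s0 : 0 <= \sum_i `|h i| by apply: sumr_ge0.
rewrite -ler_sqr ?nnegrE // hpow_normE hpow_norm_sqr expr2 mulr_suml.
apply: ler_sum => i _; rewrite expr2 ler_wpM2l // (bigD1 i) //= lerDl.
exact: sumr_ge0.
Qed.

End Norm.

Fact hpow_complete (H : completeNormedModType C) (F : set_system (hpow H)) :
  ProperFilter F -> cauchy F -> cvg F.
Proof.
move=> FF /cauchy_ballP Fc.
have Fi (i : 'I_n) : cvg ((fun h : hpow H => h i) @ F).
  apply: cauchy_cvg; apply/cauchy_ballP => e e0.
  have [[P Q] /= [FP FQ] PQ] := Fc e e0.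
  exists ([set h i | h in P], [set h i | h in Q]) => /=.
    by split; [apply: filterS FP|apply: filterS FQ] => h; exists h.
  move=> [x y] /= [[h Ph <-] [k Qk <-]].
  have /= := PQ (h, k) (conj Ph Qk); rewrite -!ball_normE /=.
  by apply: le_lt_trans; have := le_norm_coord (h - k) i; rewrite !ffunE.
pose l : hpow H := [ffun i => lim ((fun h : hpow H => h i) @ F)].
apply/cvg_ex; exists l; apply/cvgrPdist_lt => /= e e0.
have en0 : 0 < e / n.+1%:R by rewrite divr_gt0.
have : F [set h : hpow H | forall i : 'I_n, `|l i - h i| < e / n.+1%:R].
  apply: filter_forall => i.
  by have /cvgrPdist_lt/(_ _ en0) := Fi i; rewrite ffunE.
apply: filterS => h lh.
apply: le_lt_trans (hpow_norm_le_sum _) _.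
apply: (@le_lt_trans _ _ (\sum_(i < n) e / n.+1%:R)).
  by apply: ler_sum => i _; rewrite !ffunE; have := lh i; rewrite ffunE => /ltW.
rewrite sumr_const card_ord -[ltLHS]mulr_natr -mulrA gtr_pMr // mulrC.
by rewrite ltr_pdivrMr // mul1r ltr_nat.
Qed.

HB.instance Definition _ (H : completeNormedModType C) :=
  Uniform_isComplete.Build (hpow H) (@hpow_complete H).

Section Inner.
Variable H : hilbertType C.
Definition hpow_inner (h k : hpow H) : C := \sum_i inner (h i) (k i).

Fact hpow_inner_linearl k : scalar (hpow_inner ^~ k).
Proof.
move=> a u v; rewrite /hpow_inner mulr_sumr -big_split; apply: eq_bigr => i _.
by rewrite !ffunE /= inner_linearl.
Qed.

Fact hpow_innerC h k : hpow_inner k h = (hpow_inner h k)^*.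
Proof. by rewrite /hpow_inner rmorph_sum; apply: eq_bigr => i _; exact: innerC. Qed.

Fact hpow_inner_norm (h : hpow H) : hpow_inner h h = `|h| ^+ 2.
Proof.
rewrite hpow_normE hpow_norm_sqr; apply: eq_bigr => i _; exact: inner_norm.
Qed.

HB.instance Definition _ :=
  CompleteNormedModule_isHilbert.Build C (hpow H)
    hpow_inner_linearl hpow_innerC hpow_inner_norm.
End Inner.
End Power.

Section ClosedSubspaces.
Variable C : numClosedFieldType.

Record csubspace (H : normedModType C) := CSubspace {
  cs_set :> set H;
  cs_submod : GRing.submod_closed (fun x => x \in cs_set);
  cs_closed : closed cs_set
}.

Definition cs_mem (H : normedModType C) (M : csubspace H) : pred H :=
  fun x => x \in cs_set M.

Record subsp (H : normedModType C) (M : csubspace H) :=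
  Subsp { subsp_val : H; subsp_valP : cs_mem M subsp_val }.

Section Algebra.
Variables (H : normedModType C) (M : csubspace H).

HB.instance Definition _ := GRing.isSubmodClosed.Build C H (cs_mem M)
  (GRing.submod_closed_semi (cs_submod M)).
HB.instance Definition _ := [isSub for @subsp_val H M].
HB.instance Definition _ := [Choice of subsp M by <:].
HB.instance Definition _ := [SubChoice_isSubLmodule of subsp M by <:].

Definition subsp_norm (x : subsp M) : C := `|\val x|.

Fact subsp_normD x y : subsp_norm (x + y) <= subsp_norm x + subsp_norm y.
Proof. exact: ler_normD. Qed.

Fact subsp_normZ a x : subsp_norm (a *: x) = `|a| * subsp_norm x.
Proof. exact: normrZ. Qed.

Fact subsp_norm0_eq0 x : subsp_norm x = 0 -> x = 0.
Proof. by move=> /normr0_eq0 x0; apply: val_inj. Qed.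

HB.instance Definition _ :=
  Lmodule_isNormed.Build C (subsp M) subsp_normD subsp_normZ subsp_norm0_eq0.
End Algebra.

Fact subsp_complete (H : completeNormedModType C) (M : csubspace H)
    (F : set_system (subsp M)) : ProperFilter F -> cauchy F -> cvg F.
Proof.
move=> FF /cauchy_ballP Fc.
have cF : cvg (@subsp_val H M @ F).
  apply: cauchy_cvg; apply/cauchy_ballP => e e0.
  have [[P Q] /= [FP FQ] PQ] := Fc e e0.
  exists (@subsp_val H M @` P, @subsp_val H M @` Q) => /=.
    by split; [apply: filterS FP|apply: filterS FQ] => h; exists h.
  move=> [x y] /= [[h Ph <-] [k Qk <-]].
  by have /= := PQ (h, k) (conj Ph Qk); rewrite -!ball_normE.
have Ml : cs_set M (lim (@subsp_val H M @ F)).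
  apply: (closed_cvg (cs_set M) (@cs_closed _ M) _ _ cF).
  by apply: nearW => x; have := subsp_valP x; rewrite /cs_mem inE.
apply/cvg_ex; exists (Subsp (mem_set Ml)); apply/cvgrPdist_lt => /= e e0.
by have /cvgrPdist_lt/(_ _ e0) := cF.
Qed.

HB.instance Definition _ (H : completeNormedModType C) (M : csubspace H) :=
  Uniform_isComplete.Build (subsp M) (@subsp_complete H M).

Section Inner.
Variables (H : hilbertType C) (M : csubspace H).

Definition subsp_inner (x y : subsp M) : C := inner (\val x) (\val y).

Fact subsp_inner_linearl y : scalar (subsp_inner ^~ y).
Proof. by move=> a u v; rewrite /subsp_inner linearP inner_linearl. Qed.

Fact subsp_innerC x y : subsp_inner y x = (subsp_inner x y)^*.
Proof. exact: innerC. Qed.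

Fact subsp_inner_norm (x : subsp M) : subsp_inner x x = `|x| ^+ 2.
Proof. exact: inner_norm. Qed.

HB.instance Definition _ :=
  CompleteNormedModule_isHilbert.Build C (subsp M)
    subsp_inner_linearl subsp_innerC subsp_inner_norm.
End Inner.

Fact incl_proof (H : normedModType C) (M : csubspace H) :
  bounded_linear (@subsp_val H M).
Proof.
by apply/asboolP; split => //; exists 1 => x; rewrite mul1r.
Qed.

Definition incl (H : normedModType C) (M : csubspace H) : bop (subsp M) H :=
  Bop (incl_proof M).

Section ClosedRange.
Variables (H K : normedModType C) (A : bop H K).

Fact closed_range_submod :
  GRing.submod_closed (fun y => y \in closure (range A)).
Proof.
split.
  by rewrite inE; apply: subset_closure; exists 0 => //; rewrite linear0.
move=> a u v; rewrite !inE => uA vA B.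
move=> /nbhs_ballP[e /= e0 eB].
have a0 : 0 < `|a| + 1 by rewrite ltr_wpDl.
have e1 : 0 < e / 2 / (`|a| + 1) by rewrite !divr_gt0.
have e2 : 0 < e / 2 by rewrite divr_gt0.
have [_ [[x _ <-] xu]] := uA _ (nbhsx_ballx u _ e1).
have [_ [[y _ <-] yv]] := vA _ (nbhsx_ballx v _ e2).
exists (A (a *: x + y)); split; first by exists (a *: x + y).
apply: eB; move: xu yv; rewrite -!ball_normE /= => xu yv.
rewrite linearP opprD addrACA -scalerBr (le_lt_trans (ler_normD _ _)) //.
rewrite [ltRHS](splitr e) ler_ltD // normrZ.
apply: le_trans (ler_wpM2l (normr_ge0 a) (ltW xu)) _.
rewrite mulrC -[leLHS]mulrA ler_piMr ?(ltW e2) //.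
by rewrite mulrC ler_pdivrMr // mul1r lerDl.
Qed.

Definition closed_range : csubspace K :=
  CSubspace closed_range_submod (@closed_closure _ _).
End ClosedRange.

End ClosedSubspaces.
Section Operators.
Variable C : numClosedFieldType.
Local Notation "A ** B" := (op_comp A B) (at level 40, left associativity).

(* The adjoint, positive square root, inverse and orthogonal projection below
   are the operators with the stated property; the default value 0 is returned
   only where no such operator exists. *)
Definition adj (H K : hilbertType C) (A : bop H K) : bop K H :=
  xget (0 : bop K H) [set B : bop K H | forall x y, inner (A x) y = inner x (B y)].

Definition positive_op (H : hilbertType C) (A : bop H H) : Prop :=
  forall x, 0 <= inner (A x) x.

Definition op_le (H : hilbertType C) (A B : bop H H) : Prop :=
  positive_op (B - A).

Definition op_sqrt (H : hilbertType C) (A : bop H H) : bop H H :=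
  xget (0 : bop H H) [set B : bop H H | positive_op B /\ B ** B = A].

Definition op_inv (H : hilbertType C) (A : bop H H) : bop H H :=
  xget (0 : bop H H) [set B : bop H H | B ** A = op_id H /\ A ** B = op_id H].

Definition proj (H : hilbertType C) (M : csubspace H) : bop H (subsp M) :=
  xget (0 : bop H (subsp M))
    [set P : bop H (subsp M) | forall x y, inner (x - incl M (P x)) (incl M y) = 0].

Definition is_isometry (H K : hilbertType C) (A : bop H K) : Prop :=
  forall x, `|A x| = `|x|.

Definition is_unitary (H K : hilbertType C) (U : bop H K) : Prop :=
  adj U ** U = op_id H /\ U ** adj U = op_id K.

Section Tuples.
Variable n : nat.

Fact row_op_proof (H : hilbertType C) (T : 'I_n -> bop H H) :
  bounded_linear (fun h : hpow n H => \sum_i T i (h i)).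
Proof.
apply/asboolP; split.
  move=> a u v; rewrite scaler_sumr -big_split; apply: eq_bigr => i _ /=.
  by rewrite !ffunE linearP.
have /choice[M MT] : forall i, exists M : C,
    0 <= M /\ forall x, `|T i x| <= M * `|x|.
  by move=> i; have [M M0 MT] := bop_bounded_ge0 (T i); exists M.
exists (\sum_i M i) => h; rewrite mulr_suml (le_trans (ler_norm_sum _ _ _)) //.
apply: ler_sum => i _; have [M0 Mi] := MT i.
apply: le_trans (Mi _) _; apply: ler_wpM2l => //; exact: le_norm_coord.
Qed.

Definition row_op (H : hilbertType C) (T : 'I_n -> bop H H) :
  bop (hpow n H) H := Bop (row_op_proof T).

Definition commuting_tuple (H : hilbertType C) (T : 'I_n -> bop H H) : Prop :=
  forall i j, T i ** T j = T j ** T i.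

Definition contractive_tuple (H : hilbertType C) (T : 'I_n -> bop H H) : Prop :=
  op_le (\sum_i T i ** adj (T i)) (op_id H).

Definition coisometric_tuple (H : hilbertType C) (T : 'I_n -> bop H H) : Prop :=
  is_isometry (adj (row_op T)).

Definition compression (H : hilbertType C) (M : csubspace H)
    (T : 'I_n -> bop H H) : 'I_n -> bop (subsp M) (subsp M) :=
  fun i => proj M ** T i ** incl M.

Definition completely_noncoisometric (H : hilbertType C)
    (T : 'I_n -> bop H H) : Prop :=
  ~ exists M : csubspace H,
      [/\ exists2 x, cs_set M x & x != 0,
          forall i x, cs_set M x -> cs_set M (adj (T i) x)
        & coisometric_tuple (compression M T)].

Definition defect (H : hilbertType C) (T : 'I_n -> bop H H) :
    bop (hpow n H) (hpow n H) :=
  op_sqrt (op_id (hpow n H) - adj (row_op T) ** row_op T).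

Definition defect_star (H : hilbertType C) (T : 'I_n -> bop H H) : bop H H :=
  op_sqrt (op_id H - row_op T ** adj (row_op T)).

Definition defect_space (H : hilbertType C) (T : 'I_n -> bop H H) :
    csubspace (hpow n H) := closed_range (defect T).

Definition defect_star_space (H : hilbertType C) (T : 'I_n -> bop H H) :
    csubspace H := closed_range (defect_star T).

(* The norm of 'rV[C]_n is the sup norm, hence the explicit sum. *)
Definition unit_ball : set 'rV[C]_n := [set z | \sum_i `|z 0 i| ^+ 2 < 1].

Definition scalar_row (H : hilbertType C) (z : 'rV[C]_n) : bop (hpow n H) H :=
  row_op (fun i => z 0 i *: op_id H).

(* Since T D_T = D_{T^*} T, the operator between incl and proj maps
   defect_space T into defect_star_space T: proj only changes the codomain. *)
Definition char_fun (H : hilbertType C) (T : 'I_n -> bop H H) (z : 'rV[C]_n) :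
    bop (subsp (defect_space T)) (subsp (defect_star_space T)) :=
  proj (defect_star_space T)
  ** (- row_op T
      + defect_star T ** op_inv (op_id H - scalar_row H z ** adj (row_op T))
        ** scalar_row H z ** defect T)
  ** incl (defect_space T).

Definition coincide (E Es F Fs : hilbertType C)
    (phi : 'rV[C]_n -> bop E Es) (psi : 'rV[C]_n -> bop F Fs) : Prop :=
  exists (tau : bop E F) (taus : bop Es Fs),
    [/\ is_unitary tau, is_unitary taus
      & forall z, unit_ball z -> psi z ** tau = taus ** phi z].

Definition unitarily_equivalent (H K : hilbertType C)
    (T : 'I_n -> bop H H) (S : 'I_n -> bop K K) : Prop :=
  exists2 U : bop K H, is_unitary U & forall i, T i = U ** S i ** adj U.

End Tuples.
End Operators.

(* Main.v *)
(* The kernel identity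
     1 - theta(z) theta(w)^* = (1 - <z,w>) D (1 - ZT^* )^-1 (1 - TW^* )^-1 D,
   with D the defect operator of T^*, shows that a coincidence of the
   characteristic functions, through its unitary tau_* between the defect spaces
   of T^* and S^*, matches the inner products of the vectors (1 - TW^* )^-1 D x
   and (1 - SW^* )^-1 D' tau_* x. These vectors are power series in the
   conjugates of the w_i, and as T and S commute their inner products determine
   those of the coefficients, so the families T_i1 ... T_ik D x and
   S_i1 ... S_ik D' tau_* x have the same Gram matrix. The orthogonal complement
   of the first family is invariant under the T_i^*, and T^* is isometric on it;
   hence T is c.n.c. only if the family is total, and likewise for S. The unitary
   which maps one family to the other intertwines T and S.
   Conversely theta_T(z) D_T k = D (1 - ZT^* )^-1 (Zk - Tk), so that an
   equivalence of T and S transports theta_T to theta_S on the dense range of the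
   defect operator D_T. *)
Require Import Defs.
From mathcomp Require Import all_boot all_order all_algebra.
From mathcomp Require Import complex ring.
From mathcomp Require Import all_classical all_reals all_analysis.

Set Implicit Arguments.
Unset Strict Implicit.
Unset Printing Implicit Defensive.

Import Order.TTheory GRing.Theory Num.Theory.
Import numFieldNormedType.Exports.

Local Open Scope classical_set_scope.
Local Open Scope ring_scope.

(* The libraries imported after [Defs] shadow [is_unitary], [proj] and [incl]. *)
Import Defs.
Local Notation "A ** B" := (op_comp A B) (at level 40, left associativity).

(** * Inner products and completeness *)

Section InnerTheory.
Variables (C : numClosedFieldType) (H : hilbertType C).
Implicit Types (x y z : H) (a : C).

Lemma innerDl x y z : inner (x + y) z = inner x z + inner y z.
Proof. by have := inner_linearl z 1 x y; rewrite scale1r mul1r. Qed.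

Lemma inner0l z : inner 0 z = 0 :> C.
Proof. by apply: (addrI (inner 0 z)); rewrite -innerDl !addr0. Qed.

Lemma innerZl a x z : inner (a *: x) z = a * inner x z.
Proof. by have := inner_linearl z a x 0; rewrite !addr0 inner0l addr0. Qed.

Lemma innerNl x z : inner (- x) z = - inner x z.
Proof. by rewrite -scaleN1r innerZl mulN1r. Qed.

Lemma innerBl x y z : inner (x - y) z = inner x z - inner y z.
Proof. by rewrite innerDl innerNl. Qed.

Lemma innerDr x y z : inner x (y + z) = inner x y + inner x z.
Proof. by rewrite innerC innerDl rmorphD /= -!innerC. Qed.

Lemma innerZr a x z : inner x (a *: z) = a^* * inner x z.
Proof. by rewrite innerC innerZl rmorphM /= -innerC. Qed.

Lemma innerNr x z : inner x (- z) = - inner x z.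
Proof. by rewrite innerC innerNl rmorphN /= -innerC. Qed.

Lemma innerBr x y z : inner x (y - z) = inner x y - inner x z.
Proof. by rewrite innerDr innerNr. Qed.

Lemma inner0r x : inner x 0 = 0 :> C.
Proof. by rewrite innerC inner0l rmorph0. Qed.

Lemma inner_suml (I : finType) (F : I -> H) y :
  inner (\sum_i F i) y = \sum_i inner (F i) y.
Proof.
apply: (big_ind2 (fun u v => inner u y = v)) => //; first exact: inner0l.
by move=> u a v b <- <-; exact: innerDl.
Qed.

Lemma inner_ext x y : (forall z, inner x z = inner y z) -> x = y.
Proof.
move=> xy; apply/eqP; rewrite -subr_eq0 -normr_eq0 -sqrf_eq0 -inner_norm.
by rewrite innerBl xy subrr.
Qed.

Lemma inner_extr x y : (forall z, inner z x = inner z y) -> x = y.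
Proof. by move=> xy; apply: inner_ext => z; rewrite innerC xy -innerC. Qed.

Lemma cauchy_schwarz x y : `|inner x y| <= `|x| * `|y|.
Proof.
have [->|y0] := eqVneq y 0; first by rewrite inner0r !normr0 mulr0.
rewrite -ler_sqr ?nnegrE ?mulr_ge0 // exprMn.
set z := `|y| ^+ 2 *: x - inner x y *: y.
have : 0 <= inner z z by rewrite inner_norm exprn_ge0.
have -> : inner z z = `|y| ^+ 2 * (`|x| ^+ 2 * `|y| ^+ 2 - `|inner x y| ^+ 2).
  rewrite /z innerBl !innerBr !innerZl !innerZr !inner_norm (innerC x y) normCK.
  rewrite (CrealP (rpredX _ (normr_real y))); ring.
by rewrite pmulr_rge0 ?subr_ge0 // exprn_gt0 // normr_gt0.
Qed.

Lemma parallelogram x y :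
  `|x + y| ^+ 2 + `|x - y| ^+ 2 = 2 * (`|x| ^+ 2 + `|y| ^+ 2).
Proof.
rewrite -!inner_norm !(innerBl, innerDl) !(innerBr, innerDr); ring.
Qed.

End InnerTheory.

Lemma bopP (C : numClosedFieldType) (H K : normedModType C) (A B : bop H K) :
  A =1 B -> A = B.
Proof. by move=> AB; apply: val_inj; exact/funext. Qed.

(** * Limits with explicit rates, closures and infima over [R[i]] *)

Section Limits.
Variable R : realType.
Local Notation C := R[i].

Lemma invr_succ_small (e : C) : 0 < e -> exists m, (m.+1%:R)^-1 <= e.
Proof.
move=> e0; have ee : (complex.Re e)%:C%C = e by rewrite RRe_real // gtr0_real.
have r0 : 0 < complex.Re e by move: e0; rewrite -ee ltcR.
exists (Num.Def.archi_bound (complex.Re e)^-1).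
rewrite -ee -[_%:R](rmorph_nat (real_complex R)) -fmorphV /= lecR invf_ple ?posrE ?ltr0Sn //.
apply/ltW/(lt_trans (archi_boundP _)); first by rewrite invr_ge0 ltW.
by rewrite ltr_nat.
Qed.

Lemma exprn_small (r e : C) : 0 <= r -> r < 1 -> 0 < e ->
  exists m, r ^+ m <= e.
Proof.
move=> r0 r1 e0; have re : (complex.Re r)%:C%C = r by rewrite RRe_real // ger0_real.
have ee : (complex.Re e)%:C%C = e by rewrite RRe_real // gtr0_real.
move: r0 r1 e0; rewrite -re -ee -[1]/(1%:C)%C ler0c !ltcR => r0 r1 e0.
have /cvgr0Pnorm_le/(_ _ e0)[m _ /(_ m (leqnn m))] : 
    (fun m => complex.Re r ^+ m) @ \oo --> (0 : R).
  by apply: cvg_expr; rewrite ger0_norm.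
rewrite /= ger0_norm ?exprn_ge0 // => rm; exists m.
by rewrite -rmorphXn lecR.
Qed.

(** The bound is uniform in [j], so it makes the sequence Cauchy and survives the limit in [j]. *)
Lemma rate_limit (V : completeNormedModType C) (u : nat -> V) (e : nat -> C) :
    (forall m j, `|u (m + j)%N - u m| <= e m) ->
    (forall d, 0 < d -> exists m, e m <= d) ->
  exists l, forall m, `|l - u m| <= e m.
Proof.
move=> ue e0.
have : cvg (u @ \oo).
  apply: cauchy_cvg; apply: cauchy_exP => d d0.
  have [|m md] := e0 (d / 2); first by rewrite divr_gt0.
  exists (u m); exists m => //= k /= mk; rewrite -ball_normE /= distrC.
  rewrite -(subnKC mk) (le_lt_trans (ue _ _)) // (le_lt_trans md) //.
  by rewrite ltr_pdivrMr // ltr_pMr // ltr1n.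
move=> /cvgrPdist_le ul; exists (lim (u @ \oo)) => m.
apply/ler_addgt0Pr => d d0; have [N _ Nd] := ul _ d0.
have := Nd (m + N)%N (leq_addl _ _) => /= lN.
rewrite -(subrKA (u (m + N)%N)) (le_trans (ler_normD _ _)) // addrC lerD //.
Qed.

Lemma closed_approx (V : normedModType C) (A : set V) :
    (forall y, (forall e : C, 0 < e -> exists2 x, A x & `|y - x| < e) -> A y) ->
  closed A.
Proof.
move=> Acl y yA; apply: Acl => e e0.
have [x [Ax]] := yA _ (nbhsx_ballx y _ e0).
by rewrite -ball_normE; exists x.
Qed.

Lemma closure_approx (V : normedModType C) (A : set V) y (e : C) :
  closure A y -> 0 < e -> exists2 x, A x & `|y - x| < e.
Proof.
move=> yA e0; have [x [Ax]] := yA _ (nbhsx_ballx y _ e0).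
by rewrite -ball_normE; exists x.
Qed.

(** Nonnegative elements of [R[i]] are real, so the infimum is that of the real parts. *)
Lemma ge0_inf_adherent (S : set C) : S !=set0 -> (forall x, S x -> 0 <= x) ->
  exists2 i : C, (forall x, S x -> i <= x) &
    forall e, 0 < e -> exists2 x, S x & x < i + e.
Proof.
move=> [s Ss] S0.
have ReS x : S x -> (complex.Re x)%:C%C = x.
  by move=> /S0 x0; rewrite RRe_real // ger0_real.
pose E : set R := [set complex.Re x | x in S].
have iE : has_inf E.
  split; first by exists (complex.Re s); exists s.
  by exists 0 => _ [x Sx <-]; rewrite -lecR ReS // S0.
exists (inf E)%:C%C => [x Sx|e e0].
  by rewrite -(ReS _ Sx) lecR; apply: inf_lbound; [case: iE|exists x].
have ee : (complex.Re e)%:C%C = e by rewrite RRe_real // gtr0_real.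
have [|_ [x Sx <-] xe] := @inf_adherent _ E (complex.Re e) _ iE.
  by rewrite -ltcR ee.
by exists x => //; rewrite -(ReS _ Sx) -ee -rmorphD ltcR.
Qed.

End Limits.

(** * Riesz representation, adjoints and projections *)

Section Riesz.
Variable R : realType.
Local Notation C := R[i].

(* The representing vector is the minimiser of [|x|^2 - 2 Re (f x)]. *)
Lemma riesz (H : hilbertType C) (f : H -> C) (M : C) :
    scalar f -> (forall x, `|f x| <= M * `|x|) ->
  exists y, forall x, f x = inner x y.
Proof.
move=> lf fM0.
have fD x y : f (x + y) = f x + f y.
  by have := lf 1 x y; rewrite scale1r mul1r.
have f0 : f 0 = 0 by apply: (addrI (f 0)); rewrite -fD !addr0.
have fZ a x : f (a *: x) = a * f x by have := lf a x 0; rewrite !addr0 f0 addr0.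
have {M fM0} [M M0 fM] : exists2 M, 0 <= M & forall x, `|f x| <= M * `|x|.
  have [[x x0]|allx] := pselect (exists x : H, 0 < `|x|).
    exists M => //; have := le_trans (normr_ge0 _) (fM0 x).
    by rewrite pmulr_lge0.
  exists 0 => // x; have [->|x0] := eqVneq x 0; first by rewrite f0 !normr0 mulr0.
  by case: allx; exists x; rewrite normr_gt0.
pose q x := `|x| ^+ 2 - (f x + (f x)^*).
(* Adding [M ^+ 2] makes the values nonnegative: [q x + M ^+ 2 >= (|x| - M)^2]. *)
pose S : set C := [set q x + M ^+ 2 | x in setT].
have S0 s : S s -> 0 <= s.
  move=> [x _ <-].
  apply: (@le_trans _ _ ((`|x| - M) ^+ 2)).
    by rewrite real_exprn_even_ge0 // rpredB ?normr_real ?ger0_real.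
  rewrite sqrrB /q lerD2r lerD2l lerN2.
  have fr : f x + (f x)^* \is Num.real.
    by apply/CrealP; rewrite rmorphD /= conjCK addrC.
  rewrite (le_trans (real_ler_norm fr)) // (le_trans (ler_normD _ _)) //.
  by rewrite norm_conjC -mulr2n lerMn2r /= mulrC fM.
have [|i Si iS] := @ge0_inf_adherent R S _ S0; first by exists (q 0 + M ^+ 2), 0.
pose e (m : nat) : C := (m.+1%:R)^-1.
have e0 m : 0 < e m by rewrite invr_gt0 ltr0Sn.
(* The margin [e m ^+ 2 / 4] is chosen so that [q_par] yields [|u (m + j) - u m| <= e m]. *)
have /choice[u uq] : forall m, exists x, q x + M ^+ 2 < i + e m ^+ 2 / 4.
  move=> m; have [|_ [x _ <-] qx] := iS (e m ^+ 2 / 4); last by exists x.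
  by rewrite divr_gt0 // exprn_gt0.
have q_par a b : `|a - b| ^+ 2 = 2 * (q a + q b) - 4 * q (2^-1 *: (a + b)).
  have -> : `|a - b| ^+ 2 = 2 * (`|a| ^+ 2 + `|b| ^+ 2) - `|a + b| ^+ 2.
    by rewrite -parallelogram; ring.
  have n2 : `|2^-1 : C| = 2^-1 by rewrite ger0_norm // invr_ge0.
  rewrite /q normrZ fZ fD exprMn n2 rmorphM /= fmorphV rmorph_nat /= rmorphD /=.
  by field.
have [] := @rate_limit R H u e.
- move=> m j; rewrite -ler_sqr ?nnegrE ?(ltW (e0 m)) // q_par.
  have qi := Si _ (ex_intro2 _ _ (2^-1 *: (u (m + j)%N + u m)) I erefl).
  have em : e (m + j)%N ^+ 2 <= e m ^+ 2.
    rewrite ler_sqr ?nnegrE ?(ltW (e0 _)) // lef_pV2 ?posrE ?ltr0Sn //.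
    by rewrite ler_nat ltnS leq_addr.
  have -> : 2 * (q (u (m + j)%N) + q (u m)) - 4 * q (2^-1 *: (u (m + j)%N + u m))
     = 2 * ((q (u (m + j)%N) + M ^+ 2) + (q (u m) + M ^+ 2)) -
       4 * (q (2^-1 *: (u (m + j)%N + u m)) + M ^+ 2) by ring.
  have -> : e m ^+ 2 = 2 * ((i + e m ^+ 2 / 4) + (i + e m ^+ 2 / 4)) - 4 * i.
    by field.
  apply: lerB; last by rewrite ler_pM2l.
  rewrite ler_pM2l // lerD // ltW // (lt_le_trans (uq _)) // lerD2l.
  by rewrite ler_pM2r // invr_gt0.
- by move=> d d0; exact: invr_succ_small.
move=> l lu; exists l => k.
pose G h := inner h l - f h.
suff G0 : G k = 0 by apply/eqP; rewrite eq_sym -subr_eq0 -/(G k) G0.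
(* This is the minimality of [l], i.e. [q (l + h) - q l >= 0]. It comes from the near-minimality of
   [u m], with an error of at most [e m * (2 * |h| + 1/4)]. *)
have GQ h : 0 <= `|h| ^+ 2 + (G h + (G h)^*).
  apply/ler_addgt0Pr => d d0.
  have c0 : 0 < 2 * `|h| + 4^-1 by rewrite ltr_wpDl ?mulr_ge0 ?invr_gt0.
  have [|m em] := @invr_succ_small R (d / (2 * `|h| + 4^-1)); first exact: divr_gt0.
  have {}em : e m * (2 * `|h| + 4^-1) <= d by rewrite -ler_pdivlMr.
  have e1 : e m <= 1 by rewrite invf_le1 ?ltr0Sn // ler1n.
  apply: le_trans (_ : `|h| ^+ 2 + (inner h (u m) - f h + (inner h (u m) - f h)^*)
      + e m ^+ 2 / 4 <= _); last first.
    rewrite -[leLHS]addrA -[leRHS]addrA lerD2l.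
    have -> : G h + (G h)^* + d = inner h (u m) - f h + (inner h (u m) - f h)^* +
      (d + (inner h (l - u m) + (inner h (l - u m))^*)).
      by rewrite /G innerBr !rmorphB /=; ring.
    rewrite lerD2l -lerBlDr; apply: le_trans em.
    set b := inner h (l - u m).
    have br : b + b^* \is Num.real.
      by apply/CrealP; rewrite rmorphD /= conjCK addrC.
    have bn : `|b + b^*| <= 2 * (`|h| * e m).
      rewrite (le_trans (ler_normD _ _)) // norm_conjC -[leLHS]mulr2n -[leLHS]mulr_natl ler_pM2l //.
      rewrite (le_trans (cauchy_schwarz _ _)) // ler_wpM2l //.
    rewrite [leRHS]mulrDr [leRHS]addrC; apply: lerD.
      rewrite ler_pM2r ?invr_gt0 // expr2 ler_piMr // ltW //.
    by rewrite mulrCA [e m * _]mulrC (le_trans _ bn) // -normrN real_ler_norm // rpredN.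
  have qi := Si _ (ex_intro2 _ _ (u m + h) I erefl).
  have := lt_le_trans (uq m) (_ : _ <= q (u m + h) + M ^+ 2 + e m ^+ 2 / 4).
  rewrite lerD2r => /(_ qi)/ltW; rewrite [leRHS]addrAC lerD2r.
  rewrite -subr_ge0; congr (_ <= _).
  rewrite /q -!inner_norm innerDl !innerDr fD (innerC h (u m)) !rmorphD !rmorphN /=.
  by ring.
have [//|Gk0] := eqVneq (G k) 0.
(* Along [h = - s (G k)^* k] the inequality [GQ] reads [s |G k|^2 (s |k|^2 - 2) >= 0], while this
   [s] keeps [s |k|^2 < 1]. *)
pose s : C := (`|k| ^+ 2 + 1)^-1.
have k1 : 0 < `|k| ^+ 2 + 1 by rewrite ltr_wpDl // exprn_ge0.
have s0 : 0 < s by rewrite invr_gt0.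
have := GQ (- (s * (G k)^*) *: k).
have -> : G (- (s * (G k)^*) *: k) = - (s * `|G k| ^+ 2).
  by rewrite {1}/G innerZl fZ -mulrBr -/(G k) normCK; ring.
rewrite rmorphN rmorphM /= (CrealP (gtr0_real s0)) (CrealP (rpredX _ (normr_real _))).
rewrite normrZ normrN normrM norm_conjC (gtr0_norm s0).
have -> : (s * `|G k| * `|k|) ^+ 2 + (- (s * `|G k| ^+ 2) - s * `|G k| ^+ 2) =
   s * `|G k| ^+ 2 * (s * `|k| ^+ 2 - 2) by ring.
rewrite pmulr_rge0; last by rewrite mulr_gt0 ?exprn_gt0 ?normr_gt0.
rewrite subr_ge0 mulrC ler_pdivlMr // => h2.
have : `|k| ^+ 2 < `|k| ^+ 2 + 1 by rewrite ltrDl.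
move/lt_le_trans => /(_ (2 * (`|k| ^+ 2 + 1))).
have ->: `|k| ^+ 2 + 1 <= 2 * (`|k| ^+ 2 + 1) by rewrite ler_peMl ?ler1n // ltW.
by move=> /(_ isT) /lt_le_trans /(_ h2); rewrite ltxx.
Qed.

Variables (H K : hilbertType C).

(** [adj] is chosen by [xget], so one bounded operator with the property suffices; the Riesz vectors
    of the functionals [x |-> inner (A x) y] are its values. *)
Lemma adjP (A : bop H K) x y : inner (A x) y = inner x (adj A y).
Proof.
suff : exists B : bop K H, forall x y, inner (A x) y = inner x (B y).
  by move=> ex; have /= -> := @xgetPex _ (0 : bop K H) _ ex.
have [M M0 AM] := bop_bounded_ge0 A.
have /choice[B BA] : forall y, exists z, forall x, inner (A x) y = inner x z.
  move=> {}y; apply: (@riesz _ _ (M * `|y|)).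
    by move=> a u v; rewrite linearP innerDl innerZl.
  move=> {}x; by rewrite (le_trans (cauchy_schwarz _ _)) // mulrAC ler_wpM2r // AM.
suff Bb : bounded_linear B by exists (Bop Bb) => u v; rewrite BA.
apply/asboolP; split.
  move=> a u v; apply: inner_extr => z.
  by rewrite -BA innerDr innerZr !BA innerDr innerZr.
exists M => z; have [->|z0] := eqVneq (B z) 0; first by rewrite normr0 mulr_ge0.
rewrite -(ler_pM2r (_ : 0 < `|B z|)) ?normr_gt0 // -expr2 -inner_norm -BA.
rewrite -[leLHS]ger0_norm; last by rewrite BA inner_norm exprn_ge0.
by rewrite (le_trans (cauchy_schwarz _ _)) // mulrAC ler_wpM2r // AM.
Qed.

Lemma adjPr (A : bop H K) x y : inner y (A x) = inner (adj A y) x.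
Proof. by rewrite innerC adjP -innerC. Qed.

Lemma adj_unique (A : bop H K) (B : bop K H) :
  (forall x y, inner (A x) y = inner x (B y)) -> adj A = B.
Proof. by move=> AB; apply: bopP => y; apply: inner_extr => x; rewrite -adjP. Qed.

End Riesz.

Section AdjointTheory.
Variable R : realType.
Local Notation C := R[i].
Variables (H K L : hilbertType C).

Lemma adjK (A : bop H K) : adj (adj A) = A.
Proof. by apply: adj_unique => x y; rewrite adjPr. Qed.

Lemma adj_comp (A : bop K L) (B : bop H K) : adj (A ** B) = adj B ** adj A.
Proof. by apply: adj_unique => x y; rewrite /= !adjP. Qed.

Lemma unitaryP (U : bop H K) : is_unitary U <->
  (forall x, adj U (U x) = x) /\ (forall y, U (adj U y) = y).
Proof.
split=> [[U1 U2]|[U1 U2]]; split.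
- by move=> x; exact: (congr1 (fun A : bop _ _ => A x) U1).
- by move=> x; exact: (congr1 (fun A : bop _ _ => A x) U2).
- by apply: bopP => x; exact: U1.
- by apply: bopP => x; exact: U2.
Qed.

Lemma unitary_adj (U : bop H K) : is_unitary U -> is_unitary (adj U).
Proof. by move=> [U1 U2]; split; rewrite adjK. Qed.

Lemma unitary_inner (U : bop H K) x y :
  is_unitary U -> inner (U x) (U y) = inner x y.
Proof. by move=> /unitaryP[U1 _]; rewrite adjP U1. Qed.

(** The adjoint of the inclusion qualifies as the projection, since [subsp M] inherits its inner
    product from [H]. *)
Lemma projP (M : csubspace H) x y :
  inner (x - incl M (proj M x)) (incl M y) = 0.
Proof.
suff ex : exists P : bop H (subsp M),
    forall x y, inner (x - incl M (P x)) (incl M y) = 0.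
  exact: (@xgetPex _ (0 : bop H (subsp M)) _ ex x y).
exists (adj (incl M)) => {}x {}y.
by rewrite innerBl adjPr -[inner (incl M _) _]/(inner _ y) subrr.
Qed.

Lemma proj_mem (M : csubspace H) x : cs_set M x -> incl M (proj M x) = x.
Proof.
move=> Mx; pose y : subsp M := Subsp (mem_set Mx).
apply/eqP; rewrite eq_sym -subr_eq0 -normr_eq0 -sqrf_eq0 -inner_norm.
have := projP x (y - proj M x); rewrite linearB /= => ->; exact: eqxx.
Qed.

Lemma proj_adj (M : csubspace H) : proj M = adj (incl M).
Proof.
symmetry; apply: adj_unique => x y.
have := projP y x; rewrite innerBl => /subr0_eq e.
by rewrite innerC e -innerC.
Qed.

Lemma csubspace_full (M : csubspace H) :
  (forall x, (forall y, cs_set M y -> inner x y = 0) -> x = 0) ->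
  forall x, cs_set M x.
Proof.
move=> M0 x; have : x - incl M (proj M x) = 0.
  apply: M0 => y My; rewrite -(proj_mem My); exact: projP.
move=> /eqP; rewrite subr_eq0 => /eqP ->.
by have := subsp_valP (proj M x); rewrite /cs_mem inE.
Qed.

(** Totality is used as a trivial orthogonal complement: [adj A y - adj B y] is orthogonal to every
    [g i], so the adjoints agree. *)
Lemma bop_eq_total (I : Type) (g : I -> H) (A B : bop H K) :
    (forall x, (forall i, inner x (g i) = 0) -> x = 0) ->
    (forall i, A (g i) = B (g i)) -> A = B.
Proof.
move=> g0 AB; rewrite -[A]adjK -[B]adjK; congr adj; apply: bopP => y.
apply/eqP; rewrite -subr_eq0; apply/eqP/g0 => i.
by rewrite innerBl -!adjPr AB subrr.
Qed.

End AdjointTheory.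

(** * Norm limits and positive operators *)

Section OperatorLimits.
Variable R : realType.
Local Notation C := R[i].

Section Rate.
Variable e : nat -> C.
Hypothesis e_small : forall d, 0 < d -> exists m, e m <= d.

Lemma rate_eq0 (V : normedModType C) (y : V) (c : C) :
  0 <= c -> (forall m, `|y| <= e m * c) -> y = 0.
Proof.
move=> c0 ym; apply/eqP; rewrite -normr_le0; apply/ler_addgt0Pr => d d0.
have c1 : 0 < c + 1 by rewrite ltr_wpDl.
have [|m em] := e_small (d := d / (c + 1)); first exact: divr_gt0.
rewrite add0r (le_trans (ym m)) // (le_trans (ler_wpM2r c0 em)) //.
by rewrite mulrAC ler_pdivrMr // ler_pM2l // lerDl.
Qed.

Lemma bop_limit (V : normedModType C) (W : completeNormedModType C)
    (A : nat -> bop V W) :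
    (forall m j x, `|A (m + j)%N x - A m x| <= e m * `|x|) ->
  exists B : bop V W, forall m x, `|B x - A m x| <= e m * `|x|.
Proof.
move=> Ae.
have /choice[B BA] : forall x, exists l, forall m, `|l - A m x| <= e m * `|x|.
  move=> x; apply: (@rate_limit R W (fun m => A m x)) => [m j|d d0]; first exact: Ae.
  have x1 : 0 < `|x| + 1 by rewrite ltr_wpDl.
  have [|m em] := e_small (d := d / (`|x| + 1)); first exact: divr_gt0.
  exists m; rewrite (le_trans (ler_wpM2r _ em)) //.
  by rewrite mulrAC ler_pdivrMr // ler_pM2l // lerDl.
suff Bb : bounded_linear B by exists (Bop Bb).
apply/asboolP; split=> [a u v|].
  apply/eqP; rewrite -subr_eq0; apply/eqP.
  apply: (@rate_eq0 _ _ (`|a *: u + v| + (`|a| * `|u| + `|v|))).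
    by rewrite !addr_ge0 // mulr_ge0.
  move=> m; have -> : B (a *: u + v) - (a *: B u + B v) =
      (B (a *: u + v) - A m (a *: u + v)) -
      (a *: (B u - A m u) + (B v - A m v)).
    rewrite [A m (_ + _)]linearP scalerBr [a *: B u - _ + _]addrACA -opprD.
    by rewrite [in RHS]opprB addrA subrK.
  rewrite (le_trans (ler_normB _ _)) // mulrDr lerD //.
  rewrite (le_trans (ler_normD _ _)) // mulrDr lerD // normrZ.
  by rewrite mulrCA ler_wpM2l.
have [M M0 AM] := bop_bounded_ge0 (A 0%N); exists (e 0%N + M) => x.
rewrite -(subrK (A 0%N x) (B x)) (le_trans (ler_normD _ _)) // mulrDl lerD //.
Qed.

End Rate.

Section Neumann.
Variables (H : hilbertType C) (B : bop H H) (r : C).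
Hypotheses (r0 : 0 <= r) (r1 : r < 1) (Br : forall x, `|B x| <= r * `|x|).

(** [S m] is the sum of [B^k] over [k < m] in Horner form, and [e m] is the tail of the geometric
    series. *)
Let S m := iter m (fun S => op_id H + B ** S) (0 : bop H H).
Let e m := r ^+ m / (1 - r).

Lemma neumann : exists D : bop H H,
  D ** (op_id H - B) = op_id H /\ (op_id H - B) ** D = op_id H.
Proof.
have r1' : 0 < 1 - r by rewrite subr_gt0.
have e_small d : 0 < d -> exists m, e m <= d.
  move=> d0; have [|m rm] := exprn_small r0 r1 (e := d * (1 - r)).
    exact: mulr_gt0.
  by exists m; rewrite /e ler_pdivrMr.
have Se m j x : `|S (m + j)%N x - S m x| <= e m * `|x|.
  elim: m => [|m IH].
    rewrite add0n -[S 0 x]/0 subr0 /e expr0 mul1r.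
    elim: j => [|j IH]; first by rewrite normr0 mulr_ge0 // invr_ge0 ltW.
    rewrite -[S j.+1 x]/(x + B (S j x)) (le_trans (ler_normD _ _)) //.
    have -> : (1 - r)^-1 = 1 + r * (1 - r)^-1 by field; rewrite gt_eqF.
    rewrite mulrDl mul1r lerD2l (le_trans (Br _)) // -mulrA ler_wpM2l //.
  rewrite addSn -[S (m + j).+1 x]/(x + B (S (m + j)%N x)).
  rewrite -[S m.+1 x]/(x + B (S m x)) opprD addrACA subrr add0r -linearB (le_trans (Br _)) //.
  by rewrite /e exprS -!mulrA ler_wpM2l // mulrA.
have [D DS] := bop_limit e_small Se; exists D.
have BD x : D x - B (D x) = x.
  apply/eqP; rewrite -subr_eq0; apply/eqP.
  apply: (rate_eq0 e_small (c := 2 * `|x|)); first by rewrite mulr_ge0.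
  move=> m; have -> : D x - B (D x) - x = D x - S m.+1 x - B (D x - S m x).
    rewrite -[S m.+1 x]/(x + B (S m x)) [B (_ - _)]linearB /=.
    by rewrite [in RHS]opprB [in RHS]opprD !addrA subrK addrAC.
  rewrite (le_trans (ler_normB _ _)) // [2 * _]mulr_natl mulr2n mulrDr lerD //.
    rewrite (le_trans (DS _ _)) // ler_wpM2r // /e ler_pM2r ?invr_gt0 //.
    by rewrite exprS ler_piMl ?exprn_ge0 // ltW.
  rewrite (le_trans (Br _)) // (le_trans _ (DS m x)) // ler_piMl // ltW //.
(* Injectivity of [1 - B] upgrades the right inverse [D] to a two-sided one. *)
have inj y : y - B y = 0 -> y = 0.
  move=> /subr0_eq yB; apply/eqP; rewrite -normr_le0.
  have := Br y; rewrite -yB -subr_ge0 -{2}[`|y|]mul1r -mulrBl.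
  by rewrite nmulr_rge0 // subr_lt0.
split; apply: bopP => x; last exact: BD.
apply: subr0_eq; apply: inj.
rewrite -[X in X - _ - _]/(D (x - B x)) -[X in B (X - _)]/(D (x - B x)).
have := BD (x - B x); move: (D _) => z zx.
by rewrite [B _]linearB /= [- (B z - _)]opprD addrACA -opprD zx subrr.
Qed.

End Neumann.

Section PositiveOperators.
Variable H : hilbertType C.
Implicit Type A : bop H H.

(** Polarisation: [f x y = inner (A x) y - inner x (A y)] vanishes on the diagonal, which at [x + y]
    makes it antisymmetric and at ['i *: x + y] symmetric. *)
Lemma positive_selfadj A : positive_op A ->
  forall x y, inner (A x) y = inner x (A y).
Proof.
move=> A0.
have real x : inner (A x) x - inner x (A x) = 0.
  by rewrite (innerC (A x) x) (CrealP (ger0_real (A0 x))) subrr.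
pose f x y := inner (A x) y - inner x (A y).
have fC x y : f x y + f y x = 0.
  have := real (x + y); rewrite linearD !innerDl !innerDr => e.
  rewrite -{}e /f (subr0_eq (real x)) (subr0_eq (real y)); ring.
move=> x y; apply/eqP; rewrite -subr_eq0 -/(f x y).
have := fC ('i *: x) y; rewrite /f linearZ /= !innerZl !innerZr conjCi.
have /eqP := fC x y; rewrite addr_eq0 => /eqP fxy.
have -> : 'i * inner (A x) y - 'i * inner x (A y) +
   (- 'i * inner (A y) x - - 'i * inner y (A x)) = 'i * (f x y - f y x).
  by rewrite /f; ring.
move=> /eqP; rewrite mulf_eq0 (negPf (neq0Ci _)) /= -[f y x]opprK -fxy opprK.
by rewrite -mulr2n mulrn_eq0.
Qed.

(** Positivity at [y - s *: A y] gives [2 |A y|^2 <= s * c], and [s] can be taken arbitrarily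
    small. *)
Lemma positive_kernel A y : positive_op A -> inner (A y) y = 0 -> A y = 0.
Proof.
move=> A0 Ay0; have As := positive_selfadj A0.
apply/eqP; rewrite -normr_eq0 -sqrf_eq0 -inner_norm eq_le.
have n0 : 0 <= inner (A y) (A y) by rewrite inner_norm exprn_ge0.
rewrite n0 andbT.
set c := inner (A (A y)) (A y); have c0 : 0 <= c by exact: A0.
apply/ler_addgt0Pr => d d0; rewrite add0r.
have c1 : 0 < c + 1 by rewrite ltr_wpDl.
pose s : C := d / (c + 1); have s0 : 0 < s by exact: divr_gt0.
have := A0 (y - s *: A y).
rewrite linearB linearZ /= innerBl !innerBr !innerZl !innerZr Ay0.
rewrite (CrealP (gtr0_real s0)) (As (A y) y) -/c.
have -> : 0 - s * inner (A y) (A y) - (s * inner (A y) (A y) - s * (s * c)) =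
  s * (s * c - (inner (A y) (A y) + inner (A y) (A y))) by ring.
rewrite pmulr_rge0 // subr_ge0 => h.
apply: le_trans (_ : s * c <= d).
  by apply: le_trans h; rewrite lerDl.
by rewrite /s mulrAC ler_pdivrMr // ler_pM2l // lerDl.
Qed.

(** For [y = A x - D x], commutation gives [(A + D) y = A^2 x - D^2 x = 0]. Both [inner (A y) y] and
    [inner (D y) y] then vanish, so [A y = D y = 0] and [|y|^2 = inner x (A y - D y) = 0]. *)
Lemma positive_sqrt_unique A D : positive_op A -> positive_op D ->
  A ** D = D ** A -> A ** A = D ** D -> A = D.
Proof.
move=> A0 D0 ADC AD; apply: bopP => x.
have ADCx y : A (D y) = D (A y) by rewrite -[LHS]/((A ** D) y) ADC.
have ADx y : A (A y) = D (D y) by rewrite -[LHS]/((A ** A) y) AD.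
set y := A x - D x.
have /eqP : inner (A y) y + inner (D y) y = 0.
  rewrite -innerDl /y !linearB /= ADx ADCx.
  by rewrite addrC addrA subrK subrr inner0l.
rewrite paddr_eq0 // => /andP[/eqP Ay /eqP Dy].
apply: subr0_eq; apply/eqP; rewrite -normr_eq0 -sqrf_eq0 -inner_norm -/y.
rewrite {1}/y innerBl (positive_selfadj A0) (positive_selfadj D0).
by rewrite (positive_kernel A0 Ay) (positive_kernel D0 Dy) !inner0r subrr.
Qed.

End PositiveOperators.
End OperatorLimits.

(** * Positive square roots *)

Section SquareRoot.
Variable R : realType.
Local Notation C := R[i].

Lemma bop_limit_intertwine (e : nat -> C) (H K : normedModType C)
    (Z : bop H K) (A : bop H H) (B : bop K K)
    (Am : nat -> bop H H) (Bm : nat -> bop K K) :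
    (forall d, 0 < d -> exists m, e m <= d) ->
    (forall m x, `|A x - Am m x| <= e m * `|x|) ->
    (forall m y, `|B y - Bm m y| <= e m * `|y|) ->
    (forall m x, Z (Am m x) = Bm m (Z x)) ->
  forall x, Z (A x) = B (Z x).
Proof.
move=> e0 AAm BBm ZAB x; apply: subr0_eq.
have [M M0 ZM] := bop_bounded_ge0 Z.
apply: (rate_eq0 e0 (c := M * `|x| + `|Z x|)); first by rewrite addr_ge0 ?mulr_ge0.
move=> m; rewrite -(subrKA (Z (Am m x))) -linearB.
rewrite (le_trans (ler_normD _ _)) // mulrDr lerD //.
  by rewrite (le_trans (ZM _)) // mulrCA ler_wpM2l.
by rewrite ZAB distrC.
Qed.

(* The iteration [Y <- (X + Y^2) / 2] increases to [1 - sqrt (1 - X)]. On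
   scalars, with [X = 1] and [Y = 1 - d], it reads [d <- d - d^2 / 2]. *)
Definition sqrt_iter (H : hilbertType C) (X : bop H H) (m : nat) : bop H H :=
  iter m (fun Y => 2^-1 *: (X + Y ** Y)) 0.

Definition sqrt_rate (m : nat) : C := iter m (fun d => d - d ^+ 2 / 2) 1.

(** The map [d - d^2 / 2] increases on [[0, 1]], and at [2 / (m + 2)] its value falls short of
    [2 / (m + 3)] by [2 / ((m + 3) (m + 2)^2)]. *)
Lemma sqrt_rate_bounds m : 0 <= sqrt_rate m <= 2 / m.+2%:R.
Proof.
elim: m => [|m /andP[d0 db]]; first by rewrite /= ler01 divff ?pnatr_eq0 // lexx.
rewrite -[sqrt_rate m.+1]/(sqrt_rate m - sqrt_rate m ^+ 2 / 2).
set d := sqrt_rate m in d0 db *; set b := 2 / _ in db.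
have m2 : 0 < m.+2%:R :> C by rewrite ltr0Sn.
have m3 : 0 < m.+3%:R :> C by rewrite ltr0Sn.
have b1 : b <= 1 by rewrite /b ler_pdivrMr // mul1r ler_nat.
have d1 : d <= 1 by exact: le_trans b1.
have dd : d - d ^+ 2 / 2 = d * (1 - d / 2) by field.
rewrite {1}dd mulr_ge0 //=; last first.
  by rewrite subr_ge0 ler_pdivrMr // mul1r (le_trans d1) // ler1n.
apply: (@le_trans _ _ (b - b ^+ 2 / 2)).
  rewrite -subr_ge0.
  have -> : b - b ^+ 2 / 2 - (d - d ^+ 2 / 2) = (b - d) * (1 - (b + d) / 2).
    by field.
  rewrite mulr_ge0 ?subr_ge0 // ler_pdivrMr // mul1r.
  by rewrite [leRHS](_ : _ = 1 + 1) // lerD.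
rewrite -subr_ge0.
have -> : 2 / m.+3%:R - (b - b ^+ 2 / 2) = 2 / (m.+3%:R * m.+2%:R ^+ 2).
  rewrite /b; have k1 : m.+3%:R = m.+2%:R + 1 :> C by rewrite natr1.
  have := gt_eqF m2; have := gt_eqF m3; rewrite k1; move: (m.+2%:R) => k k10 k0.
  by field; rewrite k0 k10.
by rewrite divr_ge0 // mulr_ge0 ?exprn_ge0 ?ler0n.
Qed.

Lemma sqrt_rate_ge0 m : 0 <= sqrt_rate m.
Proof. by case/andP: (sqrt_rate_bounds m). Qed.

Lemma sqrt_rate_decr m : sqrt_rate m.+1 <= sqrt_rate m.
Proof. by rewrite /= gerBl divr_ge0 ?exprn_ge0 // sqrt_rate_ge0. Qed.

Lemma sqrt_rate_small d : 0 < d -> exists m, sqrt_rate m <= d.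
Proof.
move=> d0; have [|m md] := @invr_succ_small R (d / 2); first exact: divr_gt0.
exists m; have /andP[_] := sqrt_rate_bounds m; move=> /le_trans; apply.
rewrite mulrC -ler_pdivlMr // (le_trans _ md) // lef_pV2 ?posrE ?ltr0Sn //.
by rewrite ler_nat.
Qed.

Lemma sqrt_iter_intertwine (H K : hilbertType C) (Z : bop H K)
    (X : bop H H) (Y : bop K K) :
    (forall x, Z (X x) = Y (Z x)) ->
  forall m x, Z (sqrt_iter X m x) = sqrt_iter Y m (Z x).
Proof.
move=> ZX; elim=> [|m IH] x; first by rewrite linear0.
rewrite -[sqrt_iter X m.+1 x]/(2^-1 *: (X x + sqrt_iter X m (sqrt_iter X m x))).
by rewrite [Z _]linearZ linearD /= ZX !IH.
Qed.

(** * Convergence of the iteration for a self-adjoint contraction *)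

Section Limit.
Variables (H : hilbertType C) (X : bop H H).
Hypothesis X_contr : forall x, `|X x| <= `|x|.
Hypothesis X_selfadj : forall x y, inner (X x) y = inner x (X y).

Let Y := sqrt_iter X.
Let d := sqrt_rate.

Let YS m x : Y m.+1 x = 2^-1 *: (X x + Y m (Y m x)). Proof. by []. Qed.

Let n2 : `|2^-1 : C| = 2^-1. Proof. by rewrite ger0_norm // invr_ge0. Qed.

(** The scalar iteration at [X = 1] takes the values [1 - d m] and majorises the operator iteration,
    as [X] is a contraction. *)
Let Y_norm m x : `|Y m x| <= (1 - d m) * `|x|.
Proof.
elim: m x => [|m IH] x; first by rewrite normr0 subrr mul0r.
rewrite YS normrZ n2.
have -> : 1 - d m.+1 = 2^-1 * (1 + (1 - d m) ^+ 2) by rewrite /d /=; field.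
rewrite -mulrA ler_pM2l ?invr_gt0 // (le_trans (ler_normD _ _)) //.
rewrite mulrDl mul1r lerD // (le_trans (IH _)) // expr2 -mulrA ler_wpM2l //.
rewrite subr_ge0; have /andP[_ /le_trans] := sqrt_rate_bounds m; apply.
by rewrite ler_pdivrMr ?ltr0Sn // mul1r ler_nat.
Qed.

Let Y_diff m x : `|Y m.+1 x - Y m x| <= (d m - d m.+1) * `|x|.
Proof.
elim: m x => [|m IH] x.
  rewrite YS subr0 linear0 addr0 normrZ n2.
  have -> : d 0%N - d 1%N = 2^-1 by rewrite /d /=; field.
  by rewrite ler_pM2l ?invr_gt0.
(* The difference of squares splits as [P P - Q Q = P (P - Q) + (P - Q) Q], and the scalar
   increments split alike. *)
have -> : Y m.+2 x - Y m.+1 x =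
    2^-1 *: (Y m.+1 (Y m.+1 x - Y m x) + (Y m.+1 (Y m x) - Y m (Y m x))).
  rewrite [in LHS]YS [Y m.+1 x in X in _ - X = _]YS -scalerBr.
  by rewrite opprD addrACA subrr add0r [Y _ (_ - _)]linearB /= addrA subrK.
rewrite normrZ n2.
have -> : d m.+1 - d m.+2 =
    2^-1 * ((1 - d m.+1) * (d m - d m.+1) + (d m - d m.+1) * (1 - d m)).
  by rewrite /d /=; field.
rewrite -mulrA ler_pM2l ?invr_gt0 // (le_trans (ler_normD _ _)) // mulrDl lerD //.
  rewrite (le_trans (Y_norm _ _)) // -mulrA ler_wpM2l // subr_ge0.
  have /andP[_ /le_trans] := sqrt_rate_bounds m.+1; apply.
  by rewrite ler_pdivrMr ?ltr0Sn // mul1r ler_nat.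
rewrite (le_trans (IH _)) // -mulrA ler_wpM2l ?Y_norm // subr_ge0.
exact: sqrt_rate_decr.
Qed.

Let Y_cauchy m j x : `|Y (m + j)%N x - Y m x| <= d m * `|x|.
Proof.
apply: (@le_trans _ _ ((d m - d (m + j)%N) * `|x|)); last first.
  by rewrite ler_wpM2r // gerBl sqrt_rate_ge0.
elim: j => [|j IH]; first by rewrite addn0 !subrr normr0 mul0r.
rewrite addnS -(subrKA (Y (m + j)%N x)) (le_trans (ler_normD _ _)) //.
by rewrite -[d m - _](subrKA (d (m + j)%N)) mulrDl [leRHS]addrC lerD ?Y_diff.
Qed.

Let Y_selfadj m x y : inner (Y m x) y = inner x (Y m y).
Proof.
elim: m x y => [|m IH] x y; first by rewrite inner0l inner0r.
rewrite !YS innerZl innerZr innerDl innerDr X_selfadj !IH.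
by rewrite fmorphV rmorph_nat.
Qed.

(** The limit [L] of the iteration satisfies [2 L = X + L^2], so [D = 1 - L] squares to [1 - X]; it
    is positive because [|L x| <= |x|]. The rate is recorded so that [D] can inherit intertwining
    relations from its approximants. *)
Lemma sqrt_exists : exists D : bop H H,
  [/\ positive_op D, D ** D = op_id H - X &
      forall m x, `|D x - (op_id H - sqrt_iter X m) x| <= sqrt_rate m * `|x|].
Proof.
have [L LY] := bop_limit sqrt_rate_small Y_cauchy.
have L_norm x : `|L x| <= `|x|.
  by have := LY 0%N x; rewrite subr0 mul1r.
have LX x : 2^-1 *: (X x + L (L x)) = L x.
  apply: subr0_eq; apply: (rate_eq0 sqrt_rate_small (c := 2 * `|x|)).
    by rewrite mulr_ge0.
  move=> m; rewrite -(subrKA (Y m.+1 x)) (le_trans (ler_normD _ _)) //.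
  rewrite [2 * _]mulr_natl mulr2n mulrDr lerD //; last first.
    by rewrite distrC (le_trans (LY _ _)) // ler_wpM2r // sqrt_rate_decr.
  rewrite YS -scalerBr opprD addrACA subrr add0r normrZ n2.
  rewrite mulrC ler_pdivrMr // mulr_natr mulr2n.
  rewrite -(subrKA (Y m (L x))) (le_trans (ler_normD _ _)) // lerD //.
    by rewrite (le_trans (LY _ _)) // ler_wpM2l // sqrt_rate_ge0.
  rewrite -linearB (le_trans (Y_norm _ _)) // (le_trans _ (LY _ _)) //.
  by rewrite ler_piMl // gerBl sqrt_rate_ge0.
have L_selfadj x y : inner (L x) y = inner x (L y).
  apply: subr0_eq; apply: (rate_eq0 (V := C^o) sqrt_rate_small (c := 2 * (`|x| * `|y|))).
    by rewrite !mulr_ge0.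
  move=> m.
  have -> : inner (L x) y - inner x (L y) =
      inner (L x - Y m x) y - inner x (L y - Y m y).
    by rewrite innerBl innerBr Y_selfadj; ring.
  rewrite (le_trans (ler_normB _ _)) // [2 * _]mulr_natl mulr2n mulrDr lerD //.
    by rewrite (le_trans (cauchy_schwarz _ _)) // mulrA ler_wpM2r // LY.
  by rewrite (le_trans (cauchy_schwarz _ _)) // mulrCA ler_wpM2l // LY.
exists (op_id H - L); split.
- move=> x; rewrite -[X in inner X _]/(x - L x) innerBl inner_norm subr_ge0.
  have Lr : inner (L x) x \is Num.real.
    by apply/CrealP; rewrite -innerC -L_selfadj.
  rewrite (le_trans (real_ler_norm Lr)) // (le_trans (cauchy_schwarz _ _)) //.
  by rewrite expr2 ler_wpM2r.
- apply: bopP => x; rewrite -[LHS]/(x - L x - L (x - L x)) -[RHS]/(x - X x).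
  have -> : X x = 2 *: L x - L (L x).
    by rewrite -{1}LX scalerA divff ?pnatr_eq0 // scale1r addrK.
  by rewrite [L (_ - _)]linearB /= scaler_nat mulr2n -addrA -opprD addrA.
- move=> m x; rewrite -[X in X - _]/(x - L x) -[X in _ - X]/(x - Y m x).
  by rewrite opprD opprK addrACA subrr add0r addrC distrC.
Qed.

End Limit.

Section Spec.
Variables (H : hilbertType C) (A : bop H H).
Hypothesis A_contr : forall x, `|x - A x| <= `|x|.
Hypothesis A_selfadj : forall x y, inner (A x) y = inner x (A y).

(** [op_sqrt A] is a priori just some positive root, while [D] is the constructed one. The former
    commutes with its square [A], hence with the polynomials in [A] that approximate [D], hence with
    [D]; commuting positive roots agree. *)
Lemma op_sqrt_spec :
  [/\ positive_op (op_sqrt A), op_sqrt A ** op_sqrt A = A &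
      forall m x, `|op_sqrt A x - (op_id H - sqrt_iter (op_id H - A) m) x| <=
        sqrt_rate m * `|x|].
Proof.
have [||D [D0 DD DY]] := @sqrt_exists H (op_id H - A).
- exact: A_contr.
- move=> x y; rewrite -[LHS]/(inner (x - A x) y) -[RHS]/(inner x (y - A y)).
  by rewrite innerBl innerBr A_selfadj.
have {}DD : D ** D = A by rewrite DD opprB addrC subrK.
have [B0 BB] : positive_op (op_sqrt A) /\ op_sqrt A ** op_sqrt A = A.
  by apply: (@xgetPex _ 0 [set B | positive_op B /\ B ** B = A]); exists D.
suff <- : D = op_sqrt A by [].
apply: positive_sqrt_unique => //; last by rewrite BB.
apply: bopP => x; apply/esym.
apply: (bop_limit_intertwine sqrt_rate_small DY DY) => m {}x.
set B := op_sqrt A in BB *.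
have BA y : B (A y) = A (B y) by rewrite -BB.
rewrite -[LHS]/(B (x - sqrt_iter (op_id H - A) m x)) linearB /=.
congr (_ - _); apply: sqrt_iter_intertwine => y.
by rewrite -[LHS]/(B (y - A y)) linearB /= BA.
Qed.

End Spec.

(** The two roots are limits of the same polynomials at the same rate, and [Z] intertwines these
    polynomials. *)
Lemma op_sqrt_intertwine (H K : hilbertType C) (A : bop H H) (B : bop K K)
    (Z : bop H K) :
    (forall x, `|x - A x| <= `|x|) ->
    (forall x y, inner (A x) y = inner x (A y)) ->
    (forall x, `|x - B x| <= `|x|) ->
    (forall x y, inner (B x) y = inner x (B y)) ->
    (forall x, Z (A x) = B (Z x)) ->
  forall x, Z (op_sqrt A x) = op_sqrt B (Z x).
Proof.
move=> Ac As Bc Bs ZA.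
have [_ _ AY] := op_sqrt_spec Ac As; have [_ _ BY] := op_sqrt_spec Bc Bs.
apply: (bop_limit_intertwine sqrt_rate_small AY BY) => m x.
rewrite -[LHS]/(Z (x - sqrt_iter (op_id H - A) m x)) linearB /=.
congr (_ - _); apply: sqrt_iter_intertwine => y.
by rewrite -[LHS]/(Z (y - A y)) linearB /= ZA.
Qed.

End SquareRoot.

(** * Unitaries from Gram matrices, and power series *)

Section GramUnitary.
Variable R : realType.
Local Notation C := R[i].

Section Extension.
Variables (H K : hilbertType C) (I : Type) (g : I -> H) (g' : I -> K).
Hypothesis gram : forall i j, inner (g i) (g j) = inner (g' i) (g' j).

(* For the indefinite form [<u,v> - <u',v'>] on [H * K], [ortho] is the
   orthogonal of the pairs [(g i, g' i)] and [graph] their biorthogonal. By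
   [gram], [graph] is contained in [ortho], so it is isotropic, i.e. the graph
   of an isometry. *)
Let ortho v v' := forall i, inner v (g i) = inner v' (g' i).
Let graph u u' := forall v v', ortho v v' -> inner u v = inner u' v'.

Let graph_inner u u' v v' : graph u u' -> graph v v' -> inner u v = inner u' v'.
Proof. by move=> uu vv; apply: uu => i; apply: vv => j; exact: gram. Qed.

Let graph_lin a u u' v v' :
  graph u u' -> graph v v' -> graph (a *: u + v) (a *: u' + v').
Proof.
by move=> uu vv w w' ww; rewrite !innerDl !innerZl (uu _ _ ww) (vv _ _ ww).
Qed.

Let graph_norm u u' : graph u u' -> `|u'| = `|u|.
Proof.
move=> uu; apply: (@pexpIrn _ 2); rewrite ?nnegrE //.
by rewrite -!inner_norm (graph_inner uu uu).
Qed.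

Let graphB u u' v v' : graph u u' -> graph v v' -> graph (u - v) (u' - v').
Proof.
move=> uu vv; rewrite -(scaleN1r v) -(scaleN1r v') addrC [u' + _]addrC.
exact: graph_lin.
Qed.

Let graph_dom_submod :
  GRing.submod_closed (fun u => u \in [set u | exists u', graph u u']).
Proof.
split; first by rewrite inE; exists 0 => v v' _; rewrite !inner0l.
move=> a u v; rewrite !inE => -[u' uu] [v' vv].
by exists (a *: u' + v'); exact: graph_lin.
Qed.

Let graph_dom_closed : closed [set u | exists u', graph u u'].
Proof.
apply: closed_approx => y yA.
have /choice[u /all_and2[/choice[u' uu] yu]] : forall m, exists u,
    (exists u', graph u u') /\ `|y - u| < (m.+1%:R)^-1.
  by move=> m; have [|u] := yA (m.+1%:R)^-1; [rewrite invr_gt0 ltr0Sn|exists u].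
(* Both [u (m + j)] and [u m] lie within [1 / (m + 1)] of [y], hence the factor 2; since [graph] is
   isometric, the images [u'] obey the same rate. *)
pose e m : C := 2 * (m.+1%:R)^-1.
have e_small d : 0 < d -> exists m, e m <= d.
  move=> d0; have [|m md] := @invr_succ_small R (d / 2); first exact: divr_gt0.
  by exists m; rewrite /e mulrC -ler_pdivlMr.
have [||l lu] := @rate_limit R K u' e; last 1 first.
- exists l => v v' vv; apply: subr0_eq.
  apply: (rate_eq0 (V := C^o) e_small (c := `|v| + `|v'|)); first exact: addr_ge0.
  move=> m; have -> : inner y v - inner l v' = inner (y - u m) v - inner (l - u' m) v'.
    by rewrite !innerBl (uu m _ _ vv); ring.
  rewrite (le_trans (ler_normB _ _)) // mulrDr lerD //.
    rewrite (le_trans (cauchy_schwarz _ _)) // ler_wpM2r // ltW //.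
    by rewrite (lt_le_trans (yu m)) // /e ler_peMl ?ler1n // invr_ge0 ler0n.
  by rewrite (le_trans (cauchy_schwarz _ _)) // ler_wpM2r.
- move=> m j; rewrite (graph_norm (graphB (uu (m + j)%N) (uu m))).
  rewrite -(subrKA y) (le_trans (ler_normD _ _)) // /e mulr_natl mulr2n lerD //.
    rewrite distrC ltW // (lt_le_trans (yu _)) // lef_pV2 ?posrE ?ltr0Sn //.
    by rewrite ler_nat ltnS leq_addr.
  by rewrite ltW.
- exact: e_small.
Qed.

(** The domain of [graph] is a closed subspace containing every [g i], so by totality it is all of
    [H]. *)
Lemma gram_isometry : (forall x, (forall i, inner x (g i) = 0) -> x = 0) ->
  exists V : bop H K, (forall x y, inner (V x) (V y) = inner x y) /\
    forall i, V (g i) = g' i.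
Proof.
move=> gtot.
pose M := CSubspace graph_dom_submod graph_dom_closed.
have gg i : graph (g i) (g' i).
  by move=> v v' vv; rewrite (innerC v) vv -innerC.
have /choice[V VG] : forall u, exists u', graph u u'.
  apply: (@csubspace_full R H M) => x xM; apply: gtot => i; apply: xM.
  by exists (g' i).
have Vuniq u u' : graph u u' -> V u = u'.
  move=> uu; apply: subr0_eq; apply/eqP; rewrite -normr_eq0.
  by rewrite (graph_norm (graphB (VG u) uu)) subrr normr0.
have Vb : bounded_linear V.
  apply/asboolP; split; first by move=> a u v; apply: Vuniq; exact: graph_lin.
  by exists 1 => x; rewrite mul1r (graph_norm (VG x)).
exists (Bop Vb); split=> [x y|i]; last exact: Vuniq.
by rewrite (graph_inner (VG x) (VG y)).
Qed.

End Extension.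

(** The isometries built in the two directions invert each other on the total families, hence
    everywhere. *)
Lemma gram_unitary (H K : hilbertType C) (I : Type) (g : I -> H) (g' : I -> K) :
    (forall i j, inner (g i) (g j) = inner (g' i) (g' j)) ->
    (forall x, (forall i, inner x (g i) = 0) -> x = 0) ->
    (forall y, (forall i, inner y (g' i) = 0) -> y = 0) ->
  exists2 V : bop H K, is_unitary V & forall i, V (g i) = g' i.
Proof.
move=> gram gtot gtot'.
have [V [VI Vg]] := gram_isometry gram gtot.
have [W [WI Wg]] := gram_isometry (fun i j => esym (gram i j)) gtot'.
have WV : W ** V = op_id H.
  by apply: (bop_eq_total gtot) => i; rewrite /= Vg Wg.
have VW : V ** W = op_id K.
  by apply: (bop_eq_total gtot') => i; rewrite /= Wg Vg.
have aV : adj V = W.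
  by apply: adj_unique => x y; rewrite -[y in LHS]/(op_id K y) -VW /= VI.
by exists V => //; split; rewrite aV.
Qed.

End GramUnitary.

(** * Coefficients of power series in operators *)

Section PowerSeries.
Variable R : realType.
Local Notation C := R[i].

Lemma small_eq0 (V : normedModType C) (y : V) (c D : C) : 0 <= c -> 0 <= D ->
  (forall t, 0 < t -> t * c < 1 -> `|y| <= t * D) -> y = 0.
Proof.
move=> c0 D0 yt; apply/eqP; rewrite -normr_le0; apply/ler_addgt0Pr => d d0.
have k0 : 0 < D + d * c + 1 by rewrite ltr_wpDl // addr_ge0 // mulr_ge0 // ltW.
rewrite add0r (le_trans (yt (d / (D + d * c + 1)) _ _)) ?divr_gt0 //.
  rewrite mulrAC ltr_pdivrMr // mul1r addrAC ltr_pwDl //.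
  by rewrite ltr_wpDl.
by rewrite mulrAC ler_pdivrMr // ler_pM2l // -addrA lerDl addr_ge0 // mulr_ge0 // ltW.
Qed.

Section OneVariable.
Variables (E : normedModType C).
Implicit Types (A B : bop E E) (f : bop E C^o) (e : E).

Lemma iter_linearP A k a x y :
  iter k A (a *: x + y) = a *: iter k A x + iter k A y.
Proof. by elim: k => //= k ->; rewrite linearP. Qed.

Lemma iter_bounded (W : normedModType C) (f : bop E W) A k :
  exists2 N : C, 0 <= N & forall x, `|f (iter k A x)| <= N * `|x|.
Proof.
elim: k f => [|k IH] f; first exact: bop_bounded_ge0.
by have [N N0 fN] := IH (f ** A); exists N.
Qed.

(* [r = sum_k t^k A^k e], so that [f r] is a power series in [t]. *)
Lemma resolvent_moments f A e (c : C) : 0 <= c ->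
    (forall t, 0 < t -> t * c < 1 -> exists r, r = e + t *: A r /\ f r = 0) ->
  forall k, f (iter k A e) = 0.
Proof.
move=> c0 fr.
have [M M0 AM] := bop_bounded_ge0 A.
(* The condition [t * (c + 2 * M) < 1] also forces [2 * (t * M) <= 1], whence [|r| <= 2 |e|]
   uniformly in [t]. *)
have c'0 : 0 <= c + 2 * M by rewrite addr_ge0 ?mulr_ge0.
have small t : 0 < t -> t * (c + 2 * M) < 1 -> t * c < 1 /\ 2 * (t * M) <= 1.
  move=> t0; rewrite mulrDr => h; split.
    by apply: le_lt_trans h; rewrite lerDl !mulr_ge0 // ltW.
  by rewrite mulrCA (le_trans _ (ltW h)) // lerDr mulr_ge0 // ltW.
(* Since [A^k r = A^k e + t A^(k+1) r], the vanishing of [f (A^k r)] bounds [f (A^k e)] by a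
   multiple of [t]. *)
have step k : (forall t r, 0 < t -> t * (c + 2 * M) < 1 -> r = e + t *: A r ->
    f r = 0 -> f (iter k A r) = 0) -> f (iter k A e) = 0.
  move=> fk; have [N N0 fN] := iter_bounded f A k.+1.
  apply: (small_eq0 (c := c + 2 * M) (D := N * (2 * `|e|))) => //.
    by rewrite !mulr_ge0.
  move=> t t0 tc; have [tc1 tM] := small t t0 tc.
  have [r [re fr0]] := fr t t0 tc1.
  have := fk t r t0 tc re fr0; rewrite {1}re addrC iter_linearP -iterSr linearD linearZ /=.
  rewrite addrC => /eqP; rewrite addr_eq0 => /eqP ->.
  rewrite normrN normrM (gtr0_norm t0) ler_pM2l // (le_trans (fN _)) // ler_wpM2l //.
  have rn : `|r| <= `|e| + (t * M) * `|r|.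
    rewrite {1}re (le_trans (ler_normD _ _)) // lerD2l normrZ (gtr0_norm t0) -mulrA.
    by rewrite ler_pM2l.
  rewrite -(lerD2r (- `|r|)) -subr_ge0.
  have -> : 2 * `|e| - `|r| - (`|r| - `|r|) =
     2 * (`|e| + t * M * `|r| - `|r|) + (1 - 2 * (t * M)) * `|r| by ring.
  by rewrite addr_ge0 // mulr_ge0 // subr_ge0.
(* Once [f (A^k e) = 0] is known, the same expansion divided by [t] gives [f (A^(k+1) r) = 0], which
   carries the induction. *)
move=> k; apply: (step); elim: k => [//|k IH] t r t0 tc re fr0.
have := IH t r t0 tc re fr0; rewrite {1}re addrC iter_linearP -iterSr linearD linearZ /=.
by rewrite (step k IH) addr0 => /eqP; rewrite scaler_eq0 gt_eqF //= => /eqP.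
Qed.

(** The polynomial [f ((A + s B)^(k+1) e)] in [s] vanishes, and commutation turns its linear
    coefficient into [(k+1) f (B A^k e)]. *)
Lemma commuting_derivative f A B e : (forall x, A (B x) = B (A x)) ->
    (forall s k, f (iter k (A + s *: B) e) = 0) ->
  forall k, f (B (iter k A e)) = 0.
Proof.
move=> AB fs k.
(* [D m] is the derivative of [(A + s B)^m e] at [s = 0]; the recursion is the product rule. *)
pose D m := iteri m (fun j d => A d + B (iter j A e)) 0.
have DE m : D m.+1 = m.+1%:R *: B (iter m A e).
  elim: m => [|m IH]; first by rewrite /D /= linear0 add0r scale1r.
  rewrite -[D m.+2]/(A (D m.+1) + B (iter m.+1 A e)) IH linearZ /= AB.
  by rewrite -[m.+2%:R]natr1 scalerDl scale1r.
have f0 m : f (iter m A e) = 0.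
  by have := fs 0 m; rewrite scale0r addr0.
have [a a0 Aa] := bop_bounded_ge0 A; have [b b0 Bb] := bop_bounded_ge0 B.
have taylor m : exists2 N : C, 0 <= N & forall t, 0 < t -> t < 1 ->
    `|iter m (A + t *: B) e - (iter m A e + t *: D m)| <= t * t * N.
  elim: m => [|m [N N0 IH]].
    by exists 0 => // t _ _; rewrite /= scaler0 addr0 subrr normr0 mulr0.
  exists (b * `|D m| + (a + b) * N).
    by rewrite addr_ge0 // mulr_ge0 // addr_ge0.
  move=> t t0 t1.
  have [z wz zN] : exists2 z, iter m (A + t *: B) e = z + (iter m A e + t *: D m) &
      `|z| <= t * t * N.
    by exists (iter m (A + t *: B) e - (iter m A e + t *: D m));
      rewrite ?subrK ?IH.
  set w := iter m _ e in wz; rewrite -[iter m.+1 _ e]/(A w + t *: B w).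
  have -> : A w + t *: B w - (iter m.+1 A e + t *: D m.+1) =
     (t * t) *: B (D m) + (A z + t *: B z).
    rewrite -[D m.+1]/(A (D m) + B (iter m A e)) /= wz.
    do 2!rewrite [A (_ + _)]linearD /=; do 2!rewrite [B (_ + _)]linearD /=.
    rewrite [A (_ *: _)]linearZ [B (_ *: _)]linearZ /=.
    rewrite !scalerDr scalerA.
    set q := A (iter m A e); set u := t *: A (D m); set x := t *: B (iter m A e).
    rewrite addrACA [q + u + _]addrA -[q + u + x]addrA [X in _ + X - _]addrC.
    by rewrite [X in X - _]addrA addrK addrC.
  rewrite (le_trans (ler_normD _ _)) // mulrDr lerD //.
    by rewrite normrZ normrM (gtr0_norm t0) ler_wpM2l // mulr_ge0 // ltW.
  rewrite (le_trans (ler_normD _ _)) // mulrCA mulrDl lerD //.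
    by rewrite (le_trans (Aa _)) // ler_wpM2l.
  rewrite normrZ (gtr0_norm t0) (le_trans (ler_piMl _ (ltW t1))) //.
  by rewrite (le_trans (Bb _)) // ler_wpM2l.
have fD m : f (D m) = 0.
  have [N N0 tN] := taylor m; have [F F0 fF] := bop_bounded_ge0 f.
  apply: (small_eq0 (c := 1) (D := F * N)); rewrite ?mulr_ge0 //.
  move=> t t0; rewrite mulr1 => t1; rewrite -(ler_pM2l t0).
  have := le_trans (fF _) (ler_wpM2l F0 (tN t t0 t1)).
  rewrite linearB linearD linearZ /= fs f0 !add0r normrN normrZ (gtr0_norm t0).
  by have -> : F * (t * t * N) = t * (t * (F * N)) by ring.
have := fD k.+1; rewrite DE linearZ /= => /eqP.
by rewrite scaler_eq0 pnatr_eq0 => /eqP.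
Qed.

End OneVariable.

Section ManyVariables.
Variables (E : normedModType C) (n : nat) (A : 'I_n -> bop E E).
Hypothesis A_comm : forall i j x, A i (A j x) = A j (A i x).

Definition lin_comb (a : 'rV[C]_n) : bop E E := \sum_i a 0 i *: A i.

Lemma lin_combE a x : lin_comb a x = \sum_i a 0 i *: A i x.
Proof.
by apply: (big_ind2 (fun (u : bop E E) v => u x = v)) => // u v u' v' <- <-.
Qed.

Definition word_op (w : seq 'I_n) (x : E) : E := foldr (fun i y => A i y) x w.

(** With [a] rescaled into the ball, [resolvent_moments] handles the powers of every linear
    combination; differentiating in coordinate directions then produces the letters of [w] one at a
    time. *)
Lemma word_moments (f : bop E C^o) e :
    (forall a, unit_ball a -> exists r, r = e + lin_comb a r /\ f r = 0) ->
  forall w, f (word_op w e) = 0.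
Proof.
move=> fr.
have : forall a k, f (iter k (lin_comb a) e) = 0.
  move=> a; set s := \sum_i `|a 0 i| ^+ 2.
  have s0 : 0 <= s by apply: sumr_ge0 => i _; exact: exprn_ge0.
  apply: (resolvent_moments (c := 1 + s)); first exact: addr_ge0.
  move=> t t0; rewrite mulrDr mulr1 => ts.
  have t1 : t < 1 by apply: le_lt_trans ts; rewrite lerDl mulr_ge0 // ltW.
  have [|r [re fr0]] := fr (t *: a).
    apply: le_lt_trans ts.
    have -> : \sum_i `|(t *: a) 0 i| ^+ 2 = t * (t * s).
      rewrite mulrA mulr_sumr; apply: eq_bigr => i _.
      by rewrite mxE normrM (gtr0_norm t0) exprMn expr2.
    apply: (@le_trans _ _ (t * s)); last by rewrite lerDr ltW.
    by rewrite ler_piMl ?(ltW t1) // mulr_ge0 // ltW.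
  exists r; split=> //; rewrite {1}re; congr (_ + _).
  rewrite !lin_combE scaler_sumr; apply: eq_bigr => i _.
  by rewrite mxE scalerA.
(* [f] is generalised because the first letter [b] is absorbed into it as [f ** A b]. *)
move=> {fr} fe w; elim: w f fe => [|b w IH] f fe; first exact: (fe 0 0%N).
apply: (IH (f ** A b)) => a; apply: commuting_derivative.
  move=> x; rewrite !lin_combE linear_sum; apply: eq_bigr => i _.
  by rewrite linearZ /= A_comm.
move=> s k; rewrite -[RHS](fe (a + s *: delta_mx 0 b) k); congr (f _).
apply: eq_iter => x; rewrite -[LHS]/(lin_comb a x + s *: A b x) !lin_combE.
rewrite [RHS](eq_bigr (fun i => a 0 i *: A i x + (s * (i == b)%:R) *: A i x)); last first.
  by move=> i _; rewrite !mxE eqxx scalerDl.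
rewrite big_split /=; congr (_ + _).
rewrite (bigD1 b) //= eqxx mulr1 big1 ?addr0 // => i /negPf ->.
by rewrite mulr0 scale0r.
Qed.

End ManyVariables.
End PowerSeries.

(** * Defect operators and characteristic functions *)

Section Defects.
Variable R : realType.
Local Notation C := R[i].

Lemma bop_sumE (H K : normedModType C) n (A : 'I_n -> bop H K) x :
  (\sum_i A i) x = \sum_i A i x.
Proof. by apply: (big_ind2 (fun (u : bop H K) v => u x = v)) => // u v u' v' <- <-. Qed.

Section Contraction.
Variables (H K : hilbertType C) (A : bop H K).
Hypothesis A_contr : forall x, `|A x| <= `|x|.

Lemma adj_contraction x : `|adj A x| <= `|x|.
Proof.
have [->|x0] := eqVneq (adj A x) 0; first by rewrite normr0.
rewrite -(ler_pM2r (_ : 0 < `|adj A x|)) ?normr_gt0 // -expr2 -inner_norm -adjP.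
rewrite -[leLHS]ger0_norm; last by rewrite adjP inner_norm exprn_ge0.
by rewrite (le_trans (cauchy_schwarz _ _)) // mulrC ler_wpM2l.
Qed.

Let B := op_id H - adj A ** A.

Let B_contr x : `|x - B x| <= `|x|.
Proof.
rewrite -[B x]/(x - adj A (A x)) opprB addrC subrK.
by rewrite (le_trans (adj_contraction _)).
Qed.

Let B_selfadj x y : inner (B x) y = inner x (B y).
Proof.
rewrite -[B x]/(x - adj A (A x)) -[B y]/(y - adj A (A y)).
by rewrite innerBl innerBr -adjP -adjPr.
Qed.

Lemma defect_op_pos : positive_op (op_sqrt B).
Proof. by have [] := op_sqrt_spec B_contr B_selfadj. Qed.

Lemma defect_op_sqr x : op_sqrt B (op_sqrt B x) = x - adj A (A x).
Proof.
have [_ BB _] := op_sqrt_spec B_contr B_selfadj.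
by rewrite -[LHS]/((op_sqrt B ** op_sqrt B) x) BB.
Qed.

End Contraction.

(** [A (1 - A^* A) = (1 - A A^* ) A] passes to the square roots. For a row operator this is
    [T D_T = D_{T^*} T]. *)
Lemma defect_op_intertwine (H K : hilbertType C) (A : bop H K) :
    (forall x, `|A x| <= `|x|) ->
  forall x, A (op_sqrt (op_id H - adj A ** A) x) =
    op_sqrt (op_id K - A ** adj A) (A x).
Proof.
move=> Ac; have Asc := adj_contraction Ac.
apply: op_sqrt_intertwine => [x|x y|x|x y|x].
- rewrite -[X in _ - X]/(x - adj A (A x)) opprB addrC subrK.
  exact: le_trans (Asc _) (Ac _).
- rewrite -[LHS]/(inner (x - adj A (A x)) y) -[RHS]/(inner x (y - adj A (A y))).
  by rewrite innerBl innerBr -adjP -adjPr.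
- rewrite -[X in _ - X]/(x - A (adj A x)) opprB addrC subrK.
  exact: le_trans (Ac _) (Asc _).
- rewrite -[LHS]/(inner (x - A (adj A x)) y) -[RHS]/(inner x (y - A (adj A y))).
  by rewrite innerBl innerBr adjP [in RHS]adjPr.
- by rewrite -[LHS]/(A (x - adj A (A x))) linearB.
Qed.

Section ClosedRange.
Variables (H K : hilbertType C) (A : bop H K).

Lemma closed_range_mem x : cs_set (closed_range A) (A x).
Proof. by apply: subset_closure; exists x. Qed.

Lemma closed_range_map (L : hilbertType C) (M : csubspace L) (B : bop K L) :
    (forall x, cs_set M (B (A x))) ->
  forall y, cs_set (closed_range A) y -> cs_set M (B y).
Proof.
move=> MBA y yA; apply: (@cs_closed _ _ M) => U /nbhs_ballP[e /= e0 eU].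
have [N N0 BN] := bop_bounded_ge0 B.
have N1 : 0 < N + 1 by rewrite ltr_wpDl.
have [|_ [x _ <-] xy] := closure_approx yA (e := e / (N + 1)); first exact: divr_gt0.
exists (B (A x)); split=> //; apply: eU; rewrite -ball_normE /= -linearB.
rewrite (le_lt_trans (BN _)) //.
have := ltr_pM2r N1 `|y - A x| (e / (N + 1)); rewrite xy divfK ?gt_eqF // => yx.
by apply: le_lt_trans yx; rewrite mulrC ler_wpM2l // lerDl.
Qed.

Definition to_range (x : H) : subsp (closed_range A) :=
  proj (closed_range A) (A x).

Lemma incl_to_range x : incl _ (to_range x) = A x.
Proof. exact: proj_mem (@closed_range_mem x). Qed.

Lemma to_range_total (y : subsp (closed_range A)) :
  (forall x, inner y (to_range x) = 0) -> y = 0.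
Proof.
move=> yx; apply/eqP; rewrite -normr_le0; apply/ler_addgt0Pr => e e0.
rewrite add0r; have := subsp_valP y; rewrite /cs_mem inE => yA.
have [_ [x _ <-] xy] := closure_approx yA e0.
have [->|y0] := eqVneq `|y| 0; first exact: ltW.
have {}y0 : 0 < `|y| by rewrite lt_def y0 normr_ge0.
rewrite -(ler_pM2l y0) -expr2 -inner_norm -[inner y y]subr0 -(yx x) -innerBr.
rewrite -[leLHS]ger0_norm; last by rewrite innerBr yx subr0 inner_norm exprn_ge0.
rewrite (le_trans (cauchy_schwarz _ _)) // ler_wpM2l //.
by rewrite -[leLHS]/(`|incl _ y - incl _ (to_range x)|) incl_to_range ltW.
Qed.

End ClosedRange.

Lemma compress_range (E E' F F' : hilbertType C) (D : bop E E') (D' : bop F F')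
    (A : bop E' F') x y :
    A (D x) = D' y ->
  (proj (closed_range D') ** A ** incl (closed_range D)) (to_range D x) =
    to_range D' y.
Proof.
move=> ADx; rewrite -[LHS]/(proj _ (A (incl _ (to_range D x)))).
by rewrite incl_to_range ADx.
Qed.

Lemma adj_compress (E F : hilbertType C) (M : csubspace E) (N : csubspace F)
    (A : bop E F) (x : subsp N) :
    cs_set M (adj A (incl N x)) ->
  incl M (adj (proj N ** A ** incl M) x) = adj A (incl N x).
Proof.
by move=> Mx; rewrite -[RHS](proj_mem Mx) !adj_comp [proj N]proj_adj adjK -proj_adj.
Qed.

End Defects.

Section Tuple.
Variables (R : realType) (n : nat) (H : hilbertType R[i]).
Local Notation C := R[i].
Variable T : 'I_n -> bop H H.

Lemma adj_row_opE h i : adj (row_op T) h i = adj (T i) h.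
Proof.
apply: inner_extr => x; rewrite -adjP.
pose k : hpow n H := [ffun j => if j == i then x else 0].
have : inner (row_op T k) h = inner k (adj (row_op T) h) by rewrite adjP.
rewrite -[inner k _]/(\sum_j inner (k j) (adj (row_op T) h j)) (bigD1 i) //=.
rewrite [X in _ = _ + X]big1 => [|j /negPf ji]; last by rewrite ffunE ji inner0l.
rewrite ffunE eqxx addr0 => <-; rewrite (bigD1 i) //= big1 => [|j /negPf ji].
  by rewrite ffunE eqxx addr0.
by rewrite ffunE ji linear0.
Qed.

Lemma hpow_sqr (h : hpow n H) : `|h| ^+ 2 = \sum_i `|h i| ^+ 2.
Proof. by rewrite hpow_normE hpow_norm_sqr. Qed.

Lemma hpow_innerE (k l : hpow n H) : inner k l = \sum_i inner (k i) (l i).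
Proof. by []. Qed.

Hypothesis T_contr : contractive_tuple T.

Let Row := row_op T.
Let D := defect T.
Let Ds := defect_star T.

Lemma adj_row_contr h : `|adj Row h| <= `|h|.
Proof.
rewrite -ler_sqr ?nnegrE // hpow_sqr -subr_ge0.
have := T_contr h; rewrite -[X in inner X _]/(h - (\sum_i T i ** adj (T i)) h).
rewrite innerBl inner_norm bop_sumE inner_suml.
rewrite (eq_bigr (fun i => `|adj Row h i| ^+ 2)) // => i _.
by rewrite adj_row_opE -inner_norm -adjP.
Qed.

Lemma row_contr k : `|Row k| <= `|k|.
Proof. by rewrite -[Row]adjK; apply: adj_contraction adj_row_contr _. Qed.

Lemma defect_selfadj k l : inner (D k) l = inner k (D l).
Proof. by apply: positive_selfadj; exact: (defect_op_pos row_contr). Qed.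

Lemma defect_sqr k : D (D k) = k - adj Row (Row k).
Proof. by rewrite /D /defect (defect_op_sqr row_contr). Qed.

(** [Ds] is the defect operator of the contraction [adj Row], up to [adjK]. *)
Lemma defect_star_selfadj k l : inner (Ds k) l = inner k (Ds l).
Proof.
by have := positive_selfadj (defect_op_pos adj_row_contr) k l; rewrite adjK.
Qed.

Lemma defect_star_sqr k : Ds (Ds k) = k - Row (adj Row k).
Proof. by have := defect_op_sqr adj_row_contr k; rewrite adjK. Qed.

Lemma row_defect k : Row (D k) = Ds (Row k).
Proof. by rewrite /D /defect (defect_op_intertwine row_contr). Qed.

Lemma adj_row_defect_star h : adj Row (Ds h) = D (adj Row h).
Proof. by have := defect_op_intertwine adj_row_contr h; rewrite adjK. Qed.

Section Resolvent.
Variable z : 'rV[C]_n.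
Hypothesis z1 : unit_ball z.

Let Z := scalar_row H z.
Let Res := op_inv (op_id H - Z ** adj Row).

Lemma adj_scalar_rowE (h : H) i : adj Z h i = (z 0 i)^* *: h.
Proof.
apply: inner_extr => x.
pose k : hpow n H := [ffun j => if j == i then x else 0].
have : inner (\sum_j z 0 j *: k j) h = inner k (adj Z h) by rewrite -adjP.
rewrite [X in _ = X -> _]hpow_innerE (bigD1 i) //= [X in _ = X -> _](bigD1 i) //=.
rewrite big1 => [|j /negPf ji]; last by rewrite ffunE ji scaler0.
rewrite big1 => [|j /negPf ji]; last by rewrite ffunE ji inner0l.
by rewrite ffunE eqxx !addr0 innerZl innerZr conjCK => <-.
Qed.

Lemma scalar_row_norm k : `|Z k| <= sqrtC (\sum_i `|z 0 i| ^+ 2) * `|k|.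
Proof.
set s := \sum_i _; have s0 : 0 <= s by apply: sumr_ge0 => i _; exact: exprn_ge0.
have rt0 : 0 <= sqrtC s by rewrite sqrtC_ge0.
have [->|Zk0] := eqVneq (Z k) 0; first by rewrite normr0 mulr_ge0.
rewrite -(ler_pM2r (_ : 0 < `|Z k|)) ?normr_gt0 // -expr2 -inner_norm adjP.
rewrite -[leLHS]ger0_norm; last by rewrite -adjP inner_norm exprn_ge0.
rewrite (le_trans (cauchy_schwarz _ _)) // [sqrtC s * _]mulrC -mulrA ler_wpM2l //.
rewrite -ler_sqr ?nnegrE ?mulr_ge0 // exprMn hpow_sqr sqrtCK.
rewrite mulr_suml ler_sum // => i _.
by rewrite adj_scalar_rowE normrZ norm_conjC exprMn.
Qed.

(** [Z] has norm at most [|z| < 1] and [adj Row] is a contraction, so a Neumann series inverts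
    [1 - Z T^*] and [op_inv] is a true inverse. *)
Lemma op_inv_resolvent :
  Res ** (op_id H - Z ** adj Row) = op_id H /\
  (op_id H - Z ** adj Row) ** Res = op_id H.
Proof.
apply: (@xgetPex _ 0 [set B | B ** (op_id H - Z ** adj Row) = op_id H /\
  (op_id H - Z ** adj Row) ** B = op_id H]).
have s0 : 0 <= \sum_i `|z 0 i| ^+ 2.
  by apply: sumr_ge0 => i _; exact: exprn_ge0.
apply: (neumann (r := sqrtC (\sum_i `|z 0 i| ^+ 2))).
- by rewrite sqrtC_ge0.
- by rewrite -sqrtC1 ltr_sqrtC ?nnegrE.
- move=> x; rewrite (le_trans (scalar_row_norm _)) // ler_wpM2l ?sqrtC_ge0 //.
  exact: adj_row_contr.
Qed.

Lemma resolventK v : Res v - Res (Z (adj Row v)) = v.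
Proof.
have [RG _] := op_inv_resolvent.
by rewrite -linearB -[LHS]/((Res ** (op_id H - Z ** adj Row)) v) RG.
Qed.

Lemma resolventVK v : Res v - Z (adj Row (Res v)) = v.
Proof.
have [_ GR] := op_inv_resolvent.
by rewrite -[LHS]/(((op_id H - Z ** adj Row) ** Res) v) GR.
Qed.

(** [T D_T = D_{T^*} T] and [D_T^2 = 1 - T^* T] bring [Ds] to the front; the resolvent identity at
    [T k] merges the remaining terms. *)
Lemma char_fun_range k :
  char_fun T z (to_range D k) = to_range Ds (Res (Z k - Row k)).
Proof.
apply: compress_range.
rewrite -[LHS]/(- Row (D k) + Ds (Res (Z (D (D k))))) row_defect defect_sqr.
rewrite [Z _]linearB [Res (_ - _)]linearB /= -linearN -linearD; congr (Ds _).
rewrite [RHS]linearB /=; have := resolventK (Row k).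
set q := Res (Z (adj _ _)) => e.
by rewrite -[X in _ = _ - X](subrK q) e addrCA -opprD.
Qed.

(** The vector [(1 - T Z^* )^-1 D_{T^*} x], with the inverse obtained as the adjoint of the
    resolvent. *)
Definition char_kernel (x : subsp (defect_star_space T)) : H :=
  adj Res (Ds (incl _ x)).

(** This is [resolventK] read through adjoints. Iterated, it expands the vector as a power series in
    the conjugates of the [z_i]. *)
Lemma char_kernelE x :
  char_kernel x = Ds (incl _ x) + Row (adj Z (char_kernel x)).
Proof.
apply: inner_ext => v; rewrite innerDl [X in _ + X]adjP /char_kernel -!adjPr.
by apply/eqP; rewrite -subr_eq -innerBr resolventK.
Qed.

Lemma adj_char_fun x :
  incl _ (adj (char_fun T z) x) =
    D (adj Z (char_kernel x)) - adj Row (incl _ x).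
Proof.
set y : hpow n H := RHS.
pose A := - Row + Ds ** Res ** Z ** D.
have Ax : adj A (incl _ x) = y.
  apply: inner_extr => k; rewrite -adjP -[A k]/(- Row k + Ds (Res (Z (D k)))).
  rewrite innerDl innerNl /y innerBr -adjP addrC; congr (_ - _).
  by rewrite defect_star_selfadj -defect_selfadj /char_kernel -!adjP.
(* The value has to lie in [defect_space T]; it does because [T^* D_{T^*} = D_T T^*] carries the
   closed range of [D_{T^*}] into that of [D_T]. *)
rewrite -Ax; apply: adj_compress; rewrite Ax.
have := cs_submod (defect_space T) => -[_ /(_ (-1) (adj Row (incl _ x))
  (D (adj Z (char_kernel x))))].
rewrite !inE scaleN1r addrC; apply; last exact: closed_range_mem.
apply: (@closed_range_map _ _ _ Ds).
  by move=> v; rewrite adj_row_defect_star; exact: closed_range_mem.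
by have := subsp_valP x; rewrite /cs_mem inE.
Qed.

End Resolvent.

End Tuple.

(** * The kernel of the characteristic function *)

Section KernelIdentity.
Variables (R : realType) (n : nat) (H : hilbertType R[i]).
Local Notation C := R[i].
Variable T : 'I_n -> bop H H.
Hypothesis T_contr : contractive_tuple T.

(** The Halmos block operator, sending [(u, x)] to [(T u + D_{T^*} x, D_T u - T^* x)], preserves
    inner products. *)
Lemma defect_identity (x y : H) (u v : hpow n H) :
  inner (defect T u - adj (row_op T) x) (defect T v - adj (row_op T) y) =
    inner x y + inner u v -
      inner (defect_star T x + row_op T u) (defect_star T y + row_op T v).
Proof.
have e1 : inner (defect T u) (defect T v) =
    inner u v - inner (row_op T u) (row_op T v).
  by rewrite (defect_selfadj T_contr) (defect_sqr T_contr) innerBr -adjP.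
have e2 : inner (defect T u) (adj (row_op T) y) =
    inner (row_op T u) (defect_star T y).
  by rewrite (defect_selfadj T_contr) -(adj_row_defect_star T_contr) -adjP.
have e3 : inner (adj (row_op T) x) (defect T v) =
    inner (defect_star T x) (row_op T v).
  by rewrite -(defect_selfadj T_contr) -(adj_row_defect_star T_contr) -adjPr.
have e4 : inner (adj (row_op T) x) (adj (row_op T) y) =
    inner x y - inner (defect_star T x) (defect_star T y).
  rewrite (defect_star_selfadj T_contr) (defect_star_sqr T_contr) innerBr.
  by rewrite -adjPr opprB addrC subrK.
rewrite innerBl !innerBr e1 e2 e3 e4 !innerDl !innerDr; ring.
Qed.

(* This is [1 - theta(z) theta(w)^* =
   (1 - <z,w>) D (1 - ZT^* )^-1 (1 - TW^* )^-1 D], with [D] the defect operator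
   of [T^*]. *)
Lemma char_fun_kernel (w z : 'rV[C]_n) x y : unit_ball w -> unit_ball z ->
  inner (adj (char_fun T w) x) (adj (char_fun T z) y) =
    inner x y - (1 - \sum_i (w 0 i)^* * z 0 i) *
      inner (char_kernel w x) (char_kernel z y).
Proof.
move=> w1 z1; rewrite -[LHS]/(inner (incl _ (adj (char_fun T w) x))
  (incl _ (adj (char_fun T z) y))) -[inner x y]/(inner (incl _ x) (incl _ y)).
rewrite (adj_char_fun T_contr w) (adj_char_fun T_contr z) defect_identity.
(* Here [u = W^* k] for the kernel vector [k] of [x], and [D_{T^*} x + T u] is [k] itself. *)
rewrite -(char_kernelE T_contr w1) -(char_kernelE T_contr z1).
rewrite [X in _ + X - _](_ : _ = (\sum_i (w 0 i)^* * z 0 i) *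
    inner (char_kernel w x) (char_kernel z y)); first by ring.
rewrite hpow_innerE mulr_suml; apply: eq_bigr => i _.
by rewrite !adj_scalar_rowE innerZl innerZr conjCK mulrA.
Qed.

(** If the sum were 1, then [2 a b <= a^2 + b^2] in each coordinate would give
    [2 <= |w|^2 + |z|^2]. *)
Lemma one_sub_ball_inner (w z : 'rV[C]_n) : unit_ball w -> unit_ball z ->
  1 - \sum_i (w 0 i)^* * z 0 i != 0.
Proof.
move=> w1 z1; rewrite subr_eq0 eq_sym; apply/eqP => c1.
have : 1 + 1 <= \sum_i `|w 0 i| ^+ 2 + \sum_i `|z 0 i| ^+ 2.
  have c1' : `|\sum_i (w 0 i)^* * z 0 i| = 1 by rewrite c1 normr1.
  rewrite -{1 2}c1' -big_split /=.
  apply: le_trans (lerD (ler_norm_sum _ _ _) (ler_norm_sum _ _ _)) _.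
  rewrite -big_split /=; apply: ler_sum => i _; rewrite normrM norm_conjC.
  rewrite -subr_ge0; set a := `|w 0 i|; set b := `|z 0 i|.
  have -> : a ^+ 2 + b ^+ 2 - (a * b + a * b) = (a - b) ^+ 2 by ring.
  by rewrite real_exprn_even_ge0 // rpredB // normr_real.
by move=> /le_lt_trans /(_ (ltrD w1 z1)); rewrite ltxx.
Qed.

(* The subspace orthogonal to all [T^w D_* x] is invariant under the adjoints
   [T_i^*], and [T^*] is isometric on it because [D_*] vanishes there. *)
Lemma cnc_total : completely_noncoisometric T ->
  forall h, (forall (wx : seq 'I_n * subsp (defect_star_space T)),
    inner h (word_op T wx.1 (defect_star T (incl _ wx.2))) = 0) -> h = 0.
Proof.
move=> cnc h h0; apply: contrapT => /eqP hn0; apply: cnc.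
pose A := [set h : H | forall (wx : seq 'I_n * subsp (defect_star_space T)),
    inner h (word_op T wx.1 (defect_star T (incl _ wx.2))) = 0].
have A_submod : GRing.submod_closed (fun h => h \in A).
  split=> [|a u v]; first by rewrite inE => wx; rewrite inner0l.
  by rewrite !inE => Au Av wx; rewrite innerDl innerZl Au Av mulr0 addr0.
have A_closed : closed A.
  apply: closed_approx => y yA wx; set v := word_op _ _ _.
  apply/eqP; rewrite -normr_le0; apply/ler_addgt0Pr => e e0; rewrite add0r.
  have v1 : 0 < `|v| + 1 by rewrite ltr_wpDl.
  have [|x Ax /ltW yx] := yA (e / (`|v| + 1)); first exact: divr_gt0.
  rewrite -[inner y v]subr0 -(Ax wx) -innerBl (le_trans (cauchy_schwarz _ _)) //.
  rewrite (le_trans (ler_wpM2r _ yx)) // mulrAC ler_pdivrMr // ler_pM2l //.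
  by rewrite lerDl.
have A_inv i x : A x -> A (adj (T i) x).
  by move=> Ax [w y]; rewrite -adjPr; exact: (Ax (i :: w, y)).
(* The empty word gives [|Ds x|^2 = inner x (Ds (Ds x)) = 0]. *)
have ADs x : A x -> defect_star T x = 0.
  move=> Ax; apply/eqP; rewrite -normr_eq0 -sqrf_eq0 -inner_norm.
  rewrite defect_star_selfadj //.
  have := Ax ([::], to_range (defect_star T) x).
  by rewrite -[word_op _ _ _]/(defect_star T (incl _ (to_range _ x))) incl_to_range => ->.
exists (CSubspace A_submod A_closed); split=> //; first by exists h.
move=> x; set M := CSubspace _ _ in x *.
have Mx : A (incl M x) by have := subsp_valP x; rewrite /cs_mem inE.
apply: (@pexpIrn _ 2); rewrite ?nnegrE // hpow_sqr.
have -> : `|x| ^+ 2 = `|adj (row_op T) (incl M x)| ^+ 2.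
  rewrite -[in RHS]inner_norm -adjPr -[in LHS]inner_norm.
  rewrite -[inner x x]/(inner (incl M x) (incl M x)).
  apply/eqP; rewrite -subr_eq0 -innerBr -(defect_star_sqr T_contr).
  by rewrite (ADs _ Mx) linear0 inner0r.
rewrite hpow_sqr; apply: eq_bigr => i _; rewrite !adj_row_opE.
(* The adjoint of the compression is [T_i^*] restricted to the invariant subspace [M]. *)
rewrite /compression !adj_comp proj_adj adjK.
rewrite -proj_adj -[LHS]/(`|incl M (proj M (adj (T i) (incl M x)))| ^+ 2).
by rewrite proj_mem //; exact: A_inv.
Qed.

End KernelIdentity.

(** * Coinciding characteristic functions *)

Section PairMoments.
Variables (R : realType) (n : nat) (H K : hilbertType R[i]).
Local Notation C := R[i].
Variables (T : 'I_n -> bop H H) (S : 'I_n -> bop K K).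
Hypotheses (T_comm : commuting_tuple T) (S_comm : commuting_tuple S).

Lemma norm_fst_le (p : H * K) : `|p.1| <= `|p|.
Proof. by rewrite prod_normE num_le_max lexx. Qed.

Lemma norm_snd_le (p : H * K) : `|p.2| <= `|p|.
Proof. by rewrite prod_normE num_le_max lexx orbT. Qed.

Fact pair_op_proof i : bounded_linear (fun p : H * K => (T i p.1, S i p.2)).
Proof.
apply/asboolP; split=> [a [u u'] [v v']|].
  by rewrite /= !linearP.
have [M M0 TM] := bop_bounded_ge0 (T i); have [N N0 SN] := bop_bounded_ge0 (S i).
exists (M + N) => p; rewrite prod_normE num_ge_max mulrDl; apply/andP; split=> /=.
  rewrite (le_trans (TM _)) // (le_trans (ler_wpM2l M0 (norm_fst_le p))) //.
  by rewrite lerDl mulr_ge0.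
rewrite (le_trans (SN _)) // (le_trans (ler_wpM2l N0 (norm_snd_le p))) //.
by rewrite lerDr mulr_ge0.
Qed.

(** On the normed space [H * K], equality of a moment of [T] with one of [S] becomes the vanishing
    of a single functional, to which [word_moments] applies. *)
Definition pair_op i : bop (H * K)%type (H * K)%type := Bop (pair_op_proof i).

Lemma lin_comb_pair a (p : H * K) :
  lin_comb pair_op a p = (lin_comb T a p.1, lin_comb S a p.2).
Proof.
rewrite !lin_combE.
apply: (big_ind3 (fun (x : H * K) y z => x = (y, z))) => // x y z x' y' z' -> ->.
by [].
Qed.

Lemma word_op_pair w (p : H * K) :
  word_op pair_op w p = (word_op T w p.1, word_op S w p.2).
Proof. by elim: w => [|i w /= ->]; first by case: p. Qed.

Fact pair_form_proof (v : H) (v' : K) :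
  bounded_linear (fun p : H * K => (inner p.1 v - inner p.2 v' : C^o)).
Proof.
apply/asboolP; split=> [a [u u'] [w w']|].
  by rewrite /= !innerDl !innerZl -[a *: _]/(a * _); ring.
exists (`|v| + `|v'|) => p; rewrite (le_trans (ler_normB _ _)) // mulrDl lerD //.
  rewrite (le_trans (cauchy_schwarz _ _)) // mulrC ler_wpM2l //.
  exact: norm_fst_le.
rewrite (le_trans (cauchy_schwarz _ _)) // mulrC ler_wpM2l //.
exact: norm_snd_le.
Qed.

Lemma pair_moments (v e : H) (v' e' : K) :
    (forall a, unit_ball a -> exists r r', [/\ r = e + lin_comb T a r,
      r' = e' + lin_comb S a r' & inner r v = inner r' v']) ->
  forall w, inner (word_op T w e) v = inner (word_op S w e') v'.
Proof.
move=> er w; apply: subr0_eq.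
have := @word_moments R _ n pair_op _ (Bop (pair_form_proof v v')) (e, e').
move=> /(_ _ _ w); rewrite word_op_pair; apply.
  move=> i j [u u']; congr (_, _).
    exact: (congr1 (fun A : bop H H => A u) (T_comm i j)).
  exact: (congr1 (fun A : bop K K => A u') (S_comm i j)).
move=> a a1; have [r [r' [re r'e rr]]] := er a a1.
exists (r, r'); rewrite lin_comb_pair /= rr subrr; split=> //.
by congr (_, _).
Qed.

End PairMoments.

Lemma intertwine_inner_adj (R : realType) (E Es F Fs : hilbertType R[i])
    (phi phi' : bop E Es) (psi psi' : bop F Fs) (tau : bop E F)
    (taus : bop Es Fs) :
    is_unitary tau -> is_unitary taus ->
    psi ** tau = taus ** phi -> psi' ** tau = taus ** phi' ->
  forall x y, inner (adj phi x) (adj phi' y) =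
    inner (adj psi (taus x)) (adj psi' (taus y)).
Proof.
move=> tauU tausU e e' x y; have [_ tauV] := (unitaryP tau).1 tauU.
have tau_adj (f : bop E Es) (g : bop F Fs) u : g ** tau = taus ** f ->
    tau (adj f u) = adj g (taus u).
  move=> fg; apply: inner_ext => v; rewrite -(tauV v) (unitary_inner _ _ tauU).
  rewrite -!adjPr -[g _]/((g ** tau) (adj tau v)) fg.
  by rewrite [RHS](unitary_inner _ _ tausU).
by rewrite -(tau_adj _ _ _ e) -(tau_adj _ _ _ e') (unitary_inner _ _ tauU).
Qed.

Section Forward.
Variables (R : realType) (n : nat) (H K : hilbertType R[i]).
Local Notation C := R[i].
Variables (T : 'I_n -> bop H H) (S : 'I_n -> bop K K).

(** The series are expanded one argument at a time: [half] expands the first while the second stays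
    a kernel vector, and conjugate symmetry then exchanges the two. *)
Lemma kernel_word_moments (X : Type) (eT : X -> H) (eS : X -> K)
    (kT : 'rV[C]_n -> X -> H) (kS : 'rV[C]_n -> X -> K) :
    commuting_tuple T -> commuting_tuple S ->
    (forall a x, unit_ball a -> kT a x = eT x + lin_comb T a (kT a x)) ->
    (forall a x, unit_ball a -> kS a x = eS x + lin_comb S a (kS a x)) ->
    (forall a b x y, unit_ball a -> unit_ball b ->
      inner (kT a x) (kT b y) = inner (kS a x) (kS b y)) ->
  forall v w x y, inner (word_op T v (eT x)) (word_op T w (eT y)) =
    inner (word_op S v (eS x)) (word_op S w (eS y)).
Proof.
move=> T_comm S_comm kTE kSE kk v w x y.
have half b u x' y' : unit_ball b ->
    inner (word_op T u (eT x')) (kT b y') = inner (word_op S u (eS x')) (kS b y').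
  move=> b1; apply: pair_moments => // a a1.
  by exists (kT a x'), (kS a x'); split; [exact: kTE|exact: kSE|exact: kk].
apply: pair_moments => // a a1.
exists (kT a x), (kS a x); split; [exact: kTE|exact: kSE|].
by rewrite [LHS]innerC [RHS]innerC half.
Qed.

Hypotheses (T_contr : contractive_tuple T) (S_contr : contractive_tuple S).

(** Kernel vectors are series in conjugated parameters; conjugating once more gives the plain
    coefficients of [lin_comb]. *)
Let conj_row (a : 'rV[C]_n) : 'rV[C]_n := \row_i (a 0 i)^*.

Let conj_row_ball a : unit_ball a -> unit_ball (conj_row a).
Proof.
move=> a1; rewrite /unit_ball /= (eq_bigr (fun i => `|a 0 i| ^+ 2)) // => i _.
by rewrite mxE norm_conjC.
Qed.

Let kernel_series (L : hilbertType C) (A : 'I_n -> bop L L) a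
    (x : subsp (defect_star_space A)) :
  contractive_tuple A -> unit_ball a ->
  char_kernel (conj_row a) x =
    defect_star A (incl _ x) + lin_comb A a (char_kernel (conj_row a) x).
Proof.
move=> A_contr a1; rewrite {1}(char_kernelE A_contr (conj_row_ball a1)).
congr (_ + _); rewrite lin_combE; apply: eq_bigr => i _.
by rewrite adj_scalar_rowE // mxE conjCK linearZ.
Qed.

Lemma coincide_unitarily_equivalent :
    commuting_tuple T -> completely_noncoisometric T ->
    commuting_tuple S -> completely_noncoisometric S ->
  coincide (char_fun T) (char_fun S) -> unitarily_equivalent T S.
Proof.
move=> T_comm T_cnc S_comm S_cnc [tau [taus [tauU tausU tauP]]].
have kernels w z x y : unit_ball w -> unit_ball z ->
    inner (char_kernel w x) (char_kernel z y) =
    inner (char_kernel w (taus x)) (char_kernel z (taus y)).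
  move=> w1 z1.
  have := char_fun_kernel S_contr (taus x) (taus y) w1 z1.
  rewrite -(intertwine_inner_adj tauU tausU (tauP w w1) (tauP z z1)).
  rewrite (unitary_inner x y tausU) (char_fun_kernel T_contr x y w1 z1).
  (* Cancels [inner x y], then the nonzero factor [1 - <z,w>]. *)
  by move=> /addrI/oppr_inj; apply: mulfI; exact: one_sub_ball_inner.
have moments := kernel_word_moments T_comm S_comm
  (fun a x => @kernel_series H T a x T_contr)
  (fun a x => @kernel_series K S a (taus x) S_contr)
  (fun a b x y a1 b1 => kernels _ _ x y (conj_row_ball a1) (conj_row_ball b1)).
have {kernels tauP tauU tau} tausV := ((unitaryP taus).1 tausU).2.
have Ttot := cnc_total T_contr T_cnc; have Stot := cnc_total S_contr S_cnc.
have [||V VU Vg] := @gram_unitary R H K _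
  (fun wx => word_op T wx.1 (defect_star T (incl _ wx.2)))
  (fun wx => word_op S wx.1 (defect_star S (incl _ (taus wx.2))))
  (fun i j => moments i.1 j.1 i.2 j.2).
- exact: Ttot.
- move=> y yg; apply: Stot => -[w x].
  by have := yg (w, adj taus x); rewrite /= tausV.
(* On the vector of a word [w], both operators give the [S]-vector of the word [i :: w]. *)
have VT i x : V (T i x) = S i (V x).
  suff /(congr1 (fun A : bop H K => A x)) : V ** T i = S i ** V by [].
  apply: (bop_eq_total Ttot) => -[w y].
  have := Vg (w, y); have := Vg (i :: w, y) => /= e1 e2.
  by rewrite e1 e2.
exists (adj V); first exact: unitary_adj.
have [VK _] := (unitaryP V).1 VU.
by move=> i; apply: bopP => x; rewrite adjK /= -VT VK.
Qed.

End Forward.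

(** * Unitarily equivalent tuples *)

Lemma bopB (C : numClosedFieldType) (H K : normedModType C) (A : bop H K) x y :
  A (x - y) = A x - A y.
Proof. exact: linearB. Qed.

Lemma inner_to_range (R : realType) (H K : hilbertType R[i]) (A : bop H K) x y :
  inner (to_range A x) (to_range A y) = inner (A x) (A y).
Proof.
rewrite -[LHS]/(inner (incl _ (to_range A x)) (incl _ (to_range A y))).
by rewrite !incl_to_range.
Qed.

(** Both functions act on the total families through the same index map [f z], so the unitaries
    matching the Gram matrices intertwine them. *)
Lemma total_families_coincide (R : realType) (n : nat)
    (H Hs K Ks : hilbertType R[i]) (E : csubspace H) (Es : csubspace Hs)
    (F : csubspace K) (Fs : csubspace Ks) (X Xs : Type)
    (gE : X -> subsp E) (gF : X -> subsp F)
    (gEs : Xs -> subsp Es) (gFs : Xs -> subsp Fs)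
    (phi : 'rV[R[i]]_n -> bop (subsp E) (subsp Es))
    (psi : 'rV[R[i]]_n -> bop (subsp F) (subsp Fs))
    (f : 'rV[R[i]]_n -> X -> Xs) :
    (forall u, (forall x, inner u (gE x) = 0) -> u = 0) ->
    (forall u, (forall x, inner u (gF x) = 0) -> u = 0) ->
    (forall u, (forall x, inner u (gEs x) = 0) -> u = 0) ->
    (forall u, (forall x, inner u (gFs x) = 0) -> u = 0) ->
    (forall x y, inner (gE x) (gE y) = inner (gF x) (gF y)) ->
    (forall x y, inner (gEs x) (gEs y) = inner (gFs x) (gFs y)) ->
    (forall z x, unit_ball z -> phi z (gE x) = gEs (f z x)) ->
    (forall z x, unit_ball z -> psi z (gF x) = gFs (f z x)) ->
  coincide phi psi.
Proof.
move=> Etot Ftot Estot Fstot EF EsFs phiE psiE.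
have [tau tauU tauE] := gram_unitary EF Etot Ftot.
have [taus tausU tausE] := gram_unitary EsFs Estot Fstot.
exists tau, taus; split=> // z z1; apply: (bop_eq_total Etot) => x.
by rewrite /= tauE phiE // psiE // tausE.
Qed.

Lemma to_range_total_surj (R : realType) (H K : hilbertType R[i]) (A : bop H K)
    (X : Type) (W : X -> H) (u : subsp (closed_range A)) :
    (forall y, exists x, W x = y) ->
  (forall x, inner u (to_range A (W x)) = 0) -> u = 0.
Proof.
by move=> Wsurj uW; apply: to_range_total => y; have [x <-] := Wsurj y.
Qed.

Section Backward.
Variables (R : realType) (n : nat) (H K : hilbertType R[i]).
Local Notation C := R[i].
Variables (T : 'I_n -> bop H H) (S : 'I_n -> bop K K).
Hypotheses (T_contr : contractive_tuple T) (S_contr : contractive_tuple S).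

Lemma unitarily_equivalent_coincide :
  unitarily_equivalent T S -> coincide (char_fun T) (char_fun S).
Proof.
move=> [U UU TS].
have [UK UVK] := (unitaryP U).1 UU.
have [V VU [VE VK]] : exists2 V : bop H K, is_unitary V &
    (forall i x, V (T i x) = S i (V x)) /\ (forall x, V (U x) = x).
  exists (adj U); first exact: unitary_adj.
  by split=> // i x; rewrite TS /= UK.
have VTa i x : V (adj (T i) x) = adj (S i) (V x).
  apply: inner_extr => y; rewrite -adjP -[y]VK -VE !(unitary_inner _ _ VU).
  by rewrite [RHS]adjP.
pose Vn (k : hpow n H) : hpow n K := [ffun i => V (k i)].
have Vrow k : V (row_op T k) = row_op S (Vn k).
  by rewrite [LHS]linear_sum; apply: eq_bigr => i _; rewrite /= VE ffunE.
have Vn_surj l : exists k, Vn k = l.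
  by exists [ffun i => U (l i)]; apply/ffunP => i; rewrite !ffunE VK.
have Vn_inner k l : inner (Vn k) (Vn l) = inner k l.
  by rewrite !hpow_innerE; apply: eq_bigr => i _; rewrite !ffunE unitary_inner.
have Vrowa h : adj (row_op S) (V h) = Vn (adj (row_op T) h).
  by apply/ffunP => i; rewrite ffunE !adj_row_opE VTa.
(* By [char_fun_range], [theta_T(z)] sends the index [k] to [(1 - ZT^* )^-1 (Zk - Tk)]; the families
   of [S] are reindexed by [Vn] and [V]. *)
apply: (total_families_coincide (H := hpow n H) (K := hpow n K)
  (E := defect_space T) (Es := defect_star_space T)
  (F := defect_space S) (Fs := defect_star_space S) (gE := to_range (defect T))
  (gF := fun k => to_range (defect S) (Vn k)) (gEs := to_range (defect_star T))
  (gFs := fun h => to_range (defect_star S) (V h))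
  (f := fun z k => op_inv (op_id H - scalar_row H z ** adj (row_op T))
    (scalar_row H z k - row_op T k))).
- exact: (@to_range_total R (hpow n H) (hpow n H) (defect T)).
- move=> u.
  exact: (@to_range_total_surj R (hpow n K) (hpow n K) (defect S) _ Vn u).
- exact: to_range_total.
- by move=> u; apply: to_range_total_surj => y; exists (U y); exact: VK.
(* The Gram matrix involves the defect operator only through its square [1 - T^* T], which [V]
   transports directly. *)
- move=> k l; rewrite [LHS]inner_to_range [RHS]inner_to_range.
  rewrite (defect_selfadj T_contr) (defect_selfadj S_contr).
  rewrite (defect_sqr T_contr) (defect_sqr S_contr) !innerBr -!adjP.
  by rewrite -!Vrow Vn_inner unitary_inner.
- move=> k l; rewrite [LHS]inner_to_range [RHS]inner_to_range.
  rewrite (defect_star_selfadj T_contr) (defect_star_selfadj S_contr).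
  rewrite (defect_star_sqr T_contr) (defect_star_sqr S_contr) !innerBr.
  rewrite (adjPr (row_op T)) (adjPr (row_op S)).
  by rewrite !Vrowa Vn_inner unitary_inner.
- by move=> z k z1; exact: char_fun_range.
move=> z k z1; rewrite (char_fun_range S_contr z1); congr to_range.
have VZ l : V (scalar_row H z l) = scalar_row K z (Vn l).
  rewrite [LHS]linear_sum; apply: eq_bigr => i _.
  by rewrite linearZ ffunE.
rewrite -VZ -Vrow -bopB; move: (scalar_row H z k - row_op T k) => v.
(* Writing [v = (1 - Z T^* ) r] reduces the transport of the resolvent to that of [Z] and [T^*]. *)
have := resolventVK T_contr z1 v.
move: (op_inv _ v) => r /(congr1 V) <-.
rewrite bopB VZ -Vrowa bopB.
exact: (resolventK S_contr z1).
Qed.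

End Backward.

Theorem theorem3p6 (R : realType) (n : nat) (H K : hilbertType R[i])
  (T : 'I_n -> bop H H) (S : 'I_n -> bop K K)
  (T_comm : commuting_tuple T) (T_contr : contractive_tuple T)
  (T_cnc : completely_noncoisometric T)
  (S_comm : commuting_tuple S) (S_contr : contractive_tuple S)
  (S_cnc : completely_noncoisometric S) :
  coincide (char_fun T) (char_fun S) <-> unitarily_equivalent T S.
Proof.
split; first exact: coincide_unitarily_equivalent.
exact: unitarily_equivalent_coincide.
Qed.
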